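(* Let $L>0$, let $a$ satisfy (H_a), and let $\phi$ satisfy (H_φ), $\phi(0)=+\infty$, (H_int), (H_bdd). Then for every $g\in L^2(0,L)$ and every $\delta\in(0,L)$ there exists $\hat g\in L^2(0,L)$ with $\hat g=g$ a.e. on $[0,L-\delta]$ such that problem (P) with data $(a,\hat g,\phi)$ has at least one weak solution.
   Context: (H_a): $a\in L^\infty(0,L)$ and there are constants $0<\alpha<\beta$ with $\alpha\le a(x)\le\beta$ for a.e. $x\in(0,L)$. (H_φ): $\phi:\mathbb{R}\to\mathbb{R}\cup\{+\infty\}$ is continuous when $\mathbb{R}\cup\{+\infty\}$ carries its usual topology, and $\phi(s)<+\infty$ for every $s\neq0$. (H_int): $\int_0^\delta\phi(t)\,dt<+\infty$ and $\int_{-\delta}^0\phi(t)\,dt<+\infty$ for every $\delta\in(0,1)$. (H_bdd): for every $\delta>0$, $\phi$ is bounded (and continuous) on $\mathbb{R}\setminus(-\delta,\delta)$. A weak solution of problem (P) with data $(a,g,\phi)$ is a function $u$ with $u\in H^1_0(0,L)$, $\phi(u)\in L^2(0,L)$, and $-\frac{d}{dx}(a\frac{du}{dx})=-\frac{d\phi(u)}{dx}-\frac{dg}{dx}$ in $\mathcal D'(0,L)$. *)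

(* Defs.v *)
From HB Require Import structures.
From mathcomp Require Import all_boot all_order all_algebra.
From mathcomp Require Import all_classical all_reals all_analysis.
Set Implicit Arguments. Unset Strict Implicit. Unset Printing Implicit Defensive.
Import Order.TTheory GRing.Theory Num.Theory.
Import numFieldNormedType.Exports.
Local Open Scope classical_set_scope.
Local Open Scope ring_scope.

Section Defs.
Context {R : realType}.
Local Notation mu := (@lebesgue_measure R).

Definition oI (L : R) : set R := `]0%R, L[.

Definition L2 (L : R) (f : R -> R) : Prop :=
  measurable_fun (oI L) f /\
  (\int[mu]_(x in oI L) ((f x) ^+ 2)%:E < +oo)%E.

Definition smooth (psi : R -> R) : Prop :=
  forall (n : nat) (x : R), derivable (derive1n n psi) x 1.

Definition test_fun (L : R) (psi : R -> R) : Prop :=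
  smooth psi /\
  exists c d : R, [/\ 0 < c, c < d, d < L &
    forall x, (x < c \/ d < x) -> psi x = 0].

Definition weak_deriv (L : R) (u v : R -> R) : Prop :=
  forall psi, test_fun L psi ->
    (\int[mu]_(x in oI L) (u x * derive1 psi x)%:E =
     - \int[mu]_(x in oI L) (v x * psi x)%:E)%E.

Definition H10 (L : R) (u v : R -> R) : Prop :=
  [/\ L2 L u, L2 L v, weak_deriv L u v &
    exists psi : nat -> R -> R,
      (forall n, test_fun L (psi n)) /\
      (fun n => (\int[mu]_(x in oI L) ((psi n x - u x) ^+ 2)%:E +
                 \int[mu]_(x in oI L) ((derive1 (psi n) x - v x) ^+ 2)%:E)%E)
        @ \oo --> 0%E].

Definition H_a (L : R) (a : R -> R) : Prop :=
  measurable_fun (oI L) a /\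
  exists alpha beta : R, [/\ 0 < alpha, alpha < beta &
    {ae mu, forall x, x \in `]0, L[ -> alpha <= a x <= beta}].

Definition H_phi (phi : R -> \bar R) : Prop :=
  [/\ continuous phi, (forall s, phi s != -oo)%E &
      (forall s, s != 0 -> (phi s < +oo)%E)].

Definition H_int (phi : R -> \bar R) : Prop :=
  forall d : R, 0 < d < 1 ->
    (\int[mu]_(t in (`]0%R, d[ : set R)) phi t < +oo)%E /\
    (\int[mu]_(t in (`](- d)%R, 0%R[ : set R)) phi t < +oo)%E.

Definition H_bdd (phi : R -> \bar R) : Prop :=
  forall d : R, 0 < d ->
    (exists M : R, forall s, d <= `|s| -> (`|phi s| <= M%:E)%E) /\
    {within [set s | d <= `|s|], continuous phi}.

(* weak solution of (P) with data (a, g, phi):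
   u in H^1_0(0,L) with weak derivative v, phi(u) in L^2(0,L)
   (in particular finite a.e.), and
   -(a u')' = -(phi(u))' - g'  in D'(0,L), i.e. for all test psi,
   int (a u' - phi(u) - g) psi' = 0. *)
Definition weak_solution (L : R) (a g : R -> R) (phi : R -> \bar R)
    (u : R -> R) : Prop :=
  exists v : R -> R,
  [/\ H10 L u v,
      {ae mu, forall x, x \in `]0, L[ -> phi (u x) \is a fin_num},
      L2 L (fun x => fine (phi (u x))) &
      forall psi, test_fun L psi ->
        (\int[mu]_(x in oI L) (a x * v x * derive1 psi x)%:E =
         \int[mu]_(x in oI L) (fine (phi (u x)) * derive1 psi x)%:E +
         \int[mu]_(x in oI L) (g x * derive1 psi x)%:E)%E].

End Defs.

(* Main.v *)
(** Up to a constant, (P) reads a u' = phi(u) + g.  As phi is bounded below, after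
    adding a constant to phi and subtracting it from g we may take phi >= 0.  We solve
    u' = (phi(u) + g) / a with u(0) = 0 on (0,L): replace phi by its n-Lipschitz
    inf-convolutions phi_n, which increase to phi, so that the solutions u_n increase
    with n by comparison.  Testing the equation with phi_n(u_n) makes phi_n(u_n) u_n' an
    exact derivative and bounds phi_n(u_n) in L^2 by means of the integrability of phi
    at 0 only; hence u_n increases to a finite u, phi(u) is in L^2 by Fatou's lemma, and
    the L^2 bound allows passing to the limit in the integral equation.
    On the free interval (L - delta, L) we give g a large constant value, so that
    u(L) > 0, and solve a second such equation backwards from L with value 0 there and
    a large slope.  The two solutions cross; following the first one up to the crossing
    point and the second one afterwards gives u, and hat g := a u' - phi(u). *)

Require Import Defs.
From HB Require Import structures.
From mathcomp Require Import all_boot all_order all_algebra finmap.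
From mathcomp Require Import all_classical all_reals all_analysis.
From mathcomp Require Import measurable_realfun ring lra.
Import Order.TTheory GRing.Theory Num.Theory.
Import numFieldNormedType.Exports.
Local Open Scope classical_set_scope.
Local Open Scope ring_scope.

(** * Real integrals over segments *)

(** The initial value 0 is exactly where [phi] is infinite, so the equation starts on its
    singularity and the Lipschitz theory applies only to the regularisations. Monotonicity in n
    replaces compactness: u_n(x) converges at every x, and since inf-convolutions converge along
    convergent arguments, phi_n(u_n) tends to phi(u) pointwise in the extended reals. The L^2 bound
    then excludes the two remaining dangers: u lingering at 0 on a set of positive measure, and mass
    of phi_n(u_n) lost by concentration. It is uniform in n because a primitive of a continuous F
    with 0 <= F <= phi grows at most linearly on s >= 0, with constants depending on phi only. A
    first-order equation with u(0) = 0 leaves no room for u(L) = 0; the freedom of g near L pays for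
    it. Any u in H^1_0 with phi(u) in L^2 solves (P) for the datum a u' - phi(u), so beyond the
    crossing only phi(u) in L^2 is at stake, while u must return to the singular value 0 at L. The
    same singular theorem, reflected, provides such a return path. *)

(* The instance [ae_filter_ringOfSetsType], at the canonical structure that
   elaboration selects for the carrier of [lebesgue_measure]. *)
Lemma ae_filter_lebesgue (R : realType) :
  Filter (nbhs (almost_everywhere (@lebesgue_measure R))).
Proof. exact: (@ae_filter_ringOfSetsType _ (measurableTypeR R) R lebesgue_measure). Qed.
#[global] Existing Instance ae_filter_lebesgue.

Section Integrals.
Context {R : realType}.
Local Notation mu := (@lebesgue_measure R).
Implicit Types (a b c d x y : R) (f g h : R -> R).

Definition integ a b h := mu.-integrable `[a, b] (EFin \o h).
Definition intR a b h := \int[mu]_(t in `[a, b]) h t.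
(** Measurability of [h] is a separate clause, since that of its square does not imply it. *)
Definition sqint a b h :=
  measurable_fun `[a, b] h /\ integ a b (fun t => h t ^+ 2).

Lemma integ_meas {a b h} : integ a b h -> measurable_fun `[a, b] h.
Proof. by move=> /integrableP[/measurable_EFinP]. Qed.

Lemma integ_sub {a b c d h} : integ a b h -> a <= c -> d <= b -> integ c d h.
Proof.
move=> hi ac db; apply: integrableS hi => //.
by move=> t /=; rewrite !in_itv/= => /andP[ct td]; rewrite (le_trans ac)//= (le_trans td).
Qed.

Lemma meas_sub {a b c d h} : measurable_fun `[a, b] h -> a <= c -> d <= b ->
  measurable_fun `[c, d] h.
Proof.
move=> hi ac db; apply: measurable_funS hi => //.
by move=> t /=; rewrite !in_itv/= => /andP[ct td]; rewrite (le_trans ac)//= (le_trans td).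
Qed.

Lemma integ_le {a b} g h : measurable_fun `[a, b] h -> integ a b g ->
  (forall x, a <= x <= b -> `|h x| <= g x) -> integ a b h.
Proof.
move=> mh ig hg; apply: (@le_integrable _ _ _ mu _ _ _ (EFin \o g)) => //.
  exact/measurable_EFinP.
move=> x /=; rewrite in_itv/= => xab; rewrite lee_fin.
by rewrite (le_trans (hg _ xab))// ler_norm.
Qed.

Lemma integ_cst a b c : integ a b (fun=> c).
Proof.
apply: measurable_bounded_integrable => //=.
  by rewrite lebesgue_measure_itv/=; case: ifP => // _; rewrite -EFinB ltry.
exists `|c|; split; first exact: num_real.
by move=> M cM x _ /=; exact: ltW.
Qed.

Lemma integ_bdd {a b h} M : measurable_fun `[a, b] h ->
  (forall x, a <= x <= b -> `|h x| <= M) -> integ a b h.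
Proof. by move=> mh; apply: integ_le (integ_cst _ _ _). Qed.

Lemma integD {a b g h} : integ a b g -> integ a b h ->
  integ a b (fun t => g t + h t).
Proof. by move=> ig ih; exact: (integrableD _ ig ih). Qed.

Lemma integB {a b g h} : integ a b g -> integ a b h ->
  integ a b (fun t => g t - h t).
Proof. by move=> ig ih; exact: (integrableB _ ig ih). Qed.

Lemma integZ {a b h} c : integ a b h -> integ a b (fun t => c * h t).
Proof. by move=> ig; exact: (integrableZl _ c ig). Qed.

Lemma integ_norm {a b h} : integ a b h -> integ a b (fun t => `|h t|).
Proof. by move=> ig; exact: (integrable_abse ig). Qed.

Lemma integ_eq {a b} g h : integ a b g -> (forall x, a <= x <= b -> g x = h x) ->
  integ a b h.
Proof.
move=> ig gh; apply: (@eq_integrable _ _ _ mu _ _ (EFin \o g)) => // x.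
by rewrite inE/= in_itv/= => /gh ->.
Qed.

Lemma intR_eq {a b} g h : (forall x, a <= x <= b -> g x = h x) ->
  intR a b g = intR a b h.
Proof.
by move=> gh; apply: eq_Rintegral => x; rewrite inE/= in_itv/= => /gh.
Qed.

Lemma intR_le {a b} g h : integ a b g -> integ a b h ->
  (forall x, a <= x <= b -> g x <= h x) -> intR a b g <= intR a b h.
Proof. by move=> ig ih gh; apply: le_Rintegral. Qed.

Lemma intR_ge0 {a b h} : (forall x, a <= x <= b -> 0 <= h x) -> 0 <= intR a b h.
Proof. by move=> h0; apply: Rintegral_ge0 => x /=; rewrite in_itv/= => /h0. Qed.

Lemma intRD {a b g h} : integ a b g -> integ a b h ->
  intR a b (fun t => g t + h t) = intR a b g + intR a b h.
Proof. by move=> *; exact: RintegralD. Qed.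

Lemma intRB {a b g h} : integ a b g -> integ a b h ->
  intR a b (fun t => g t - h t) = intR a b g - intR a b h.
Proof. by move=> *; exact: RintegralB. Qed.

Lemma intRZ {a b h} c : integ a b h ->
  intR a b (fun t => c * h t) = c * intR a b h.
Proof. by move=> *; exact: RintegralZl. Qed.

Lemma intR_norm {a b h} : integ a b h ->
  `|intR a b h| <= intR a b (fun t => `|h t|).
Proof. by move=> ih; exact: le_normr_Rintegral. Qed.

Lemma intR_cst a b c : a <= b -> intR a b (fun=> c) = c * (b - a).
Proof.
move=> ab; rewrite /intR Rintegral_cst//=.
rewrite [X in fine X]lebesgue_measure_itv/= lte_fin.
by case: ltgtP ab => //= ->; rewrite subrr.
Qed.

Lemma intR_pt a h : intR a a h = 0.
Proof. by rewrite /intR set_itv1 Rintegral_set1. Qed.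

(** The convention for reversed segments is 0, not a change of sign; this is why [intR_chasles] asks
    for ordered points and why primitives below are started from a lower bound of their
    arguments. *)
Lemma intR_gt a b h : b < a -> intR a b h = 0.
Proof. by move=> ba; rewrite /intR set_itv_ge ?Rintegral_set0// bnd_simp -ltNge. Qed.

Lemma intR_chasles {a} b {c h} : integ a c h -> a <= b <= c ->
  intR a c h = intR a b h + intR b c h.
Proof.
move=> ih /andP[ab bc].
have := @Rintegral_itvB _ h (BLeft a) (BRight c) b ih.
rewrite !bnd_simp => /(_ ab bc) /eqP; rewrite subr_eq => /eqP.
rewrite /intR => ->; rewrite addrC; congr (_ + _).
rewrite Rintegral_itv_obnd_cbnd//.
apply: integrableS ih => // t /=; rewrite !in_itv/= => /andP[/ltW bt ->].
by rewrite (le_trans ab bt).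
Qed.

Lemma intR_incr {a} x y {h} : integ a y h -> (forall t, a <= t <= y -> 0 <= h t) ->
  x <= y -> intR a x h <= intR a y h.
Proof.
move=> ih h0 xy; have [ax|xa] := leP a x.
  rewrite (@intR_chasles a x y)// ?ax// lerDl.
  by apply: intR_ge0 => t /andP[xt ty]; apply: h0; rewrite (le_trans ax).
by rewrite (intR_gt _ _ _ xa); exact: intR_ge0.
Qed.

Lemma intR_cont {a b h} : a <= b -> integ a b h ->
  {within `[a, b], continuous (fun x => intR a x h)}.
Proof. exact: parameterized_integral_continuous. Qed.

Lemma intR_le_bd {a b h} M : a <= b -> integ a b h ->
  (forall x, a <= x <= b -> h x <= M) -> intR a b h <= M * (b - a).
Proof.
move=> ab ih hM; rewrite -intR_cst//; apply: intR_le => //; exact: integ_cst.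
Qed.

Lemma sqint_integ {a b h} : sqint a b h -> integ a b h.
Proof.
move=> [mh ih]; apply: (integ_le (fun t => 1 + h t ^+ 2)) => //.
  by apply: integD => //; exact: integ_cst.
move=> x _; rewrite ler_norml; apply/andP; split; nra.
Qed.

Lemma sqint_mul {a b g h} : sqint a b g -> sqint a b h ->
  integ a b (fun t => g t * h t).
Proof.
move=> [mg ig] [mh ih]; apply: (integ_le (fun t => g t ^+ 2 + h t ^+ 2)) => //.
- exact: measurable_funM.
- exact: integD.
move=> x _; rewrite ler_norml; apply/andP; split; nra.
Qed.

Lemma sqintD {a b g h} : sqint a b g -> sqint a b h ->
  sqint a b (fun t => g t + h t).
Proof.
move=> [mg ig] [mh ih]; have mgh : measurable_fun `[a, b] (fun t => g t + h t).
  exact: measurable_funD.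
split=> //; apply: (integ_le (fun t => 2 * (g t ^+ 2 + h t ^+ 2))).
- exact: measurable_funX.
- exact/integZ/integD.
move=> x _; rewrite ger0_norm ?sqr_ge0//.
by have := sqr_ge0 (g x - h x); nra.
Qed.

Lemma sqintM_bdd {a b g h} M : measurable_fun `[a, b] g ->
  (forall x, a <= x <= b -> `|g x| <= M) -> sqint a b h ->
  sqint a b (fun t => g t * h t).
Proof.
move=> mg gM [mh ih]; have mgh : measurable_fun `[a, b] (fun t => g t * h t).
  exact: measurable_funM.
split=> //; apply: (integ_le (fun t => M ^+ 2 * (h t ^+ 2))).
- exact: measurable_funX.
- exact/integZ.
move=> x /gM gxM; rewrite ger0_norm ?sqr_ge0// exprMn ler_wpM2r ?sqr_ge0//.
by rewrite -[g x ^+ 2]real_normK ?num_real// lerXn2r// ?nnegrE// (le_trans _ gxM).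
Qed.

Lemma sqint_bdd {a b h} M : measurable_fun `[a, b] h ->
  (forall x, a <= x <= b -> `|h x| <= M) -> sqint a b h.
Proof.
move=> mh hM; split=> //; apply: (integ_bdd (M ^+ 2)); first exact: measurable_funX.
move=> x /hM hxM; rewrite normrX lerXn2r// ?nnegrE// (le_trans _ hxM)//.
Qed.

Lemma sqint_norm {a b h} : sqint a b h -> sqint a b (fun t => `|h t|).
Proof.
move=> [mh ih]; split; first exact: measurableT_comp.
by apply: integ_eq ih _ => x _; rewrite real_normK// num_real.
Qed.

Lemma sqintZ {a b h} c : sqint a b h -> sqint a b (fun t => c * h t).
Proof. by apply: (@sqintM_bdd _ _ (fun=> c) _ `|c|). Qed.

Lemma sqintB {a b g h} : sqint a b g -> sqint a b h ->
  sqint a b (fun t => g t - h t).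
Proof.
move=> sg sh; have := sqintD sg (sqintZ (-1) sh).
by under eq_fun do rewrite mulN1r.
Qed.

Lemma sqint_sub {a b c d h} : sqint a b h -> a <= c -> d <= b -> sqint c d h.
Proof.
by move=> [mh ih] ac db; split; [exact: meas_sub ac db|exact: integ_sub ac db].
Qed.

(** The variance of [h] about its mean [t] is nonnegative. *)
Lemma cauchy_schwarz_intR {a b h} : a <= b -> sqint a b h ->
  intR a b h ^+ 2 <= (b - a) * intR a b (fun t => h t ^+ 2).
Proof.
rewrite le_eqVlt => /predU1P[->|ab] sh; first by rewrite !intR_pt mulr0 expr0n.
pose m := intR a b h; pose t := m / (b - a).
have ba : 0 < b - a by rewrite subr_gt0.
have : 0 <= intR a b (fun x => (h x - t) ^+ 2).
  by apply: intR_ge0 => x _; exact: sqr_ge0.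
have ih := sqint_integ sh; have ih2 := sh.2.
have i1 : integ a b (fun x => 2 * t * h x) by exact: integZ.
have -> : intR a b (fun x => (h x - t) ^+ 2) =
    intR a b (fun x => h x ^+ 2 - 2 * t * h x + t ^+ 2).
  by apply: intR_eq => x _; ring.
rewrite intRD; [|exact: integB|exact: integ_cst].
rewrite intRB// intRZ//.
rewrite (intR_cst _ _ _ (ltW ab)) -/m => H.
have -> : m ^+ 2 = (b - a) * (2 * t * m - t ^+ 2 * (b - a)).
  by rewrite /t; field; rewrite gt_eqF.
by rewrite ler_pM2l//; move: H; set A := intR _ _ _; lra.
Qed.

Lemma intR_dct {a b} (f_ : nat -> R -> R) f g :
  (forall n, measurable_fun `[a, b] (f_ n)) -> measurable_fun `[a, b] f ->
  integ a b g ->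
  (forall n x, a <= x <= b -> `|f_ n x| <= g x) ->
  {ae mu, forall x, a <= x <= b -> f_ ^~ x @ \oo --> f x} ->
  intR a b (f_ n) @[n --> \oo] --> intR a b f.
Proof.
move=> mf_ mf ig fg fcv.
have fcv' : {ae mu, forall x, `[a, b]%classic x ->
    (fun n => EFin \o f_ n) ^~ x @ \oo --> (EFin \o f) x}.
  apply: filterS fcv => x /= H; rewrite in_itv/= => /H {}H.
  by apply: cvg_EFin => //; near=> n.
have fg' : {ae mu, forall x n, `[a, b]%classic x ->
    (`|(EFin \o f_ n) x| <= (EFin \o g) x)%E}.
  by apply: aeW => x n /=; rewrite in_itv/= => xab; rewrite lee_fin fg.
have [] := @dominated_convergence _ _ _ mu `[a, b] (measurable_itv _)
  (fun n => EFin \o f_ n) (EFin \o f) (EFin \o g).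
- by move=> n; apply/measurable_EFinP; exact: mf_.
- exact/measurable_EFinP.
- exact: fcv'.
- by [].
- exact: fg'.
move=> intf _.
have -> : (\int[mu]_(x in `[a, b]) (EFin \o f) x = (intR a b f)%:E)%E.
  by rewrite fineK//; apply: integrable_fin_num.
by move=> cv; exact: (fine_cvg cv).
Unshelve. all: by end_near. Qed.

Lemma intR_ext_measurable {a b} h u : integ a b h -> a <= b ->
  (forall x, a <= x <= b -> u x = intR a x h) -> measurable_fun `[a, b] u.
Proof.
move=> ih ab uE.
apply: (eq_measurable_fun (fun x => intR a x h)).
  by move=> x; rewrite inE/= in_itv/= => /uE.
apply: subspace_continuous_measurable_fun => //; exact: intR_cont.
Qed.

End Integrals.

(** * Gronwall estimates *)

Section Calculus.
Context {R : realType}.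
Local Notation mu := (@lebesgue_measure R).
Implicit Types (a b c d x y : R) (f g h u v w : R -> R).

Lemma le0_harmonic (a M : R) : (forall n, a <= M / n.+1%:R) -> a <= 0.
Proof.
move=> H; rewrite leNgt; apply/negP => a0.
have M0 : 0 <= `|M| / a by rewrite divr_ge0// ltW.
pose n := Num.bound (`|M| / a).
have := archi_boundP M0; rewrite -/n ltr_pdivrMr// => Mn.
have := H n; rewrite ler_pdivlMr// leNgt => /negP; apply.
by rewrite (le_lt_trans (ler_norm M))// (lt_le_trans Mn)// mulrC ler_pM2l// ler_nat.
Qed.

Lemma le0_geometric (a M : R) : 0 <= M -> (forall n, a <= M / 2 ^+ n) -> a <= 0.
Proof.
move=> M0 H; apply: (@le0_harmonic _ M) => n; apply: le_trans (H n) _.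
rewrite ler_wpM2l// lef_pV2 ?posrE ?exprn_gt0//.
by rewrite -natrX ler_nat ltn_expl.
Qed.

Lemma derive_expRM (l x : R) :
  is_derive x 1 (fun t => expR (l * t)) (l * expR (l * x)).
Proof.
have H : is_derive x 1 (fun t => l * t) l.
  by have := is_deriveZ l (is_derive_id x (1:R)); rewrite /GRing.scale/= mulr1.
have := @is_derive1_comp R expR (fun t => l * t) x _ _ _ H.
by move/(_ (expR (l * x)) (is_derive_expR _)); rewrite mulrC.
Qed.

Lemma cont_expRM (l : R) : continuous (fun t => expR (l * t)).
Proof.
move=> x; apply: differentiable_continuous; apply/derivable1_diffP.
exact: (@ex_derive _ _ _ _ _ _ _ (derive_expRM l x)).
Qed.

Lemma integ_cont {a b h} : continuous h -> integ a b h.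
Proof.
move=> ch; have [ab|ba] := leP a b; last first.
  by rewrite /integ set_itv_ge ?bnd_simp -?ltNge//; exact: integrable_set0.
by apply: continuous_compact_integrable; [exact: segment_compact|exact: continuous_subspaceT].
Qed.

Lemma intR_derive {a b} (F f : R -> R) : a <= b -> continuous f ->
  (forall x, is_derive x 1 F (f x)) -> intR a b f = F b - F a.
Proof.
rewrite le_eqVlt => /predU1P[->|ab] cf dF; first by rewrite intR_pt subrr.
have cF : continuous F.
  move=> x; apply: differentiable_continuous; apply/derivable1_diffP.
  exact: (@ex_derive _ _ _ _ _ _ _ (dF x)).
rewrite /intR /Rintegral (@continuous_FTC2 _ _ F _ _ ab)//.
- exact: continuous_subspaceT.
- split.
  + by move=> x _; exact: (@ex_derive _ _ _ _ _ _ _ (dF x)).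
  + by apply: cvg_at_right_filter; exact: cF.
  + by apply: cvg_at_left_filter; exact: cF.
- by move=> x _; rewrite derive1E; exact: (@derive_val _ _ _ _ _ _ _ (dF x)).
Qed.

Lemma intR_expR (l x : R) : 0 < l -> 0 <= x ->
  intR 0 x (fun t => expR (l * t)) <= expR (l * x) / l.
Proof.
move=> l0 x0.
have -> : intR 0 x (fun t => expR (l * t)) =
    l^-1 * expR (l * x) - l^-1 * expR (l * 0).
  apply: (@intR_derive 0 x (fun t : R => l^-1 * expR (l * t))) => //.
    exact: cont_expRM.
  move=> y; have H := is_deriveZ l^-1 (derive_expRM l y).
  by move: H; rewrite /GRing.scale/= mulKf// gt_eqF.
by rewrite mulrC lerBlDr lerDl mulr_ge0 ?expR_ge0// invr_ge0 ltW.
Qed.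

(* The weight exp(l t) turns the Volterra operator into a contraction of norm 1/l. *)
Lemma volterra_weight {x h} (C l : R) : 0 <= C -> 0 < l -> 0 <= x -> integ 0 x h ->
  (forall t, 0 <= t <= x -> h t <= C * expR (l * t)) ->
  intR 0 x h <= C / l * expR (l * x).
Proof.
move=> C0 l0 x0 ih hC.
have ie : integ 0 x (fun t => expR (l * t)) by apply: integ_cont; exact: cont_expRM.
apply: (@le_trans _ _ (intR 0 x (fun t => C * expR (l * t)))).
  by apply: intR_le => //; exact: integZ.
by rewrite intRZ// -mulrA ler_wpM2l// mulrC intR_expR.
Qed.

(** In the norm weighted by exp(2 K x), each use of the integral inequality halves the bound on [w],
    which therefore vanishes. *)
Lemma gronwall (L B K : R) w : 0 < K -> measurable_fun `[0, L] w ->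
  (forall x, 0 <= x <= L -> 0 <= w x <= B) ->
  (forall x, 0 <= x <= L -> w x <= K * intR 0 x w) ->
  forall x, 0 <= x <= L -> w x = 0.
Proof.
move=> K0 mw wB wK.
have iw : integ 0 L w.
  by apply: (integ_bdd B) => // x /wB /andP[w0 wb]; rewrite ger0_norm.
have K20 : 0 < 2 * K by rewrite mulr_gt0.
have B0 x : 0 <= x <= L -> 0 <= B by move=> /wB /andP[]; exact: le_trans.
have wk k : forall x, 0 <= x <= L -> w x <= B / 2 ^+ k * expR (2 * K * x).
  elim: k => [|k IH] x xL; have /andP[x0 xL'] := xL; have Bx := B0 _ xL.
    rewrite expr0 divr1; have /andP[_ wb] := wB _ xL; apply: le_trans wb _.
    by rewrite ler_peMr// -expR0 ler_expR !mulr_ge0// ltW.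
  apply: le_trans (wK _ xL) _.
  have -> : B / 2 ^+ k.+1 * expR (2 * K * x) =
      K * (B / 2 ^+ k / (2 * K) * expR (2 * K * x)).
    rewrite exprS; field; rewrite expf_neq0//=; lra.
  rewrite ler_pM2l//; apply: volterra_weight => //.
  - by rewrite divr_ge0// exprn_ge0.
  - exact: (integ_sub iw (lexx _) xL').
  - by move=> t /andP[t0 tx]; apply: IH; rewrite t0 (le_trans tx).
move=> x xL; apply/eqP; rewrite eq_le; have /andP[-> _] := wB _ xL; rewrite andbT.
apply: (@le0_geometric _ (B * expR (2 * K * x))).
  by rewrite mulr_ge0 ?expR_ge0// (B0 x).
by move=> n; rewrite mulrAC; exact: wk.
Qed.

(** Over n + 1 equal steps the increments of [h] add up to at most x / (n + 1) times the total
    increment of [W]. This replaces almost everywhere differentiation in the proofs of the chain and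
    product rules. *)
Lemma const_of_superlinear (L : R) h W :
  (forall x y, 0 <= y <= x -> x <= L -> `|h x - h y| <= (x - y) * (W x - W y)) ->
  forall x, 0 <= x <= L -> h x = h 0.
Proof.
move=> H x /andP[x0 xL].
suff : `|h x - h 0| <= 0 by rewrite normr_le0 subr_eq0 => /eqP.
apply: (@le0_harmonic _ (x * (W x - W 0))) => n.
pose p i : R := x * i%:R / n.+1%:R.
have pS i : p i.+1 - p i = x / n.+1%:R.
  by rewrite /p -natr1; field; rewrite -(natrD _ 1) pnatr_eq0.
have p0 : p 0%N = 0 by rewrite /p mulr0 mul0r.
have pn : p n.+1 = x by rewrite /p mulfK.
have p_ge0 i : 0 <= p i by rewrite /p divr_ge0 ?mulr_ge0.
have p_le i : (i <= n.+1)%N -> p i <= x.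
  by move=> ile; rewrite /p ler_pdivrMr// ler_wpM2l// ler_nat.
have : forall i, (i <= n.+1)%N ->
    `|h (p i) - h 0| <= x / n.+1%:R * (W (p i) - W 0).
  elim=> [|i IH] ile; first by rewrite p0 !subrr normr0 mulr0.
  have -> : h (p i.+1) - h 0 = (h (p i.+1) - h (p i)) + (h (p i) - h 0).
    by rewrite addrA subrK.
  apply: le_trans (ler_normD _ _) _.
  have -> : x / n.+1%:R * (W (p i.+1) - W 0) =
      x / n.+1%:R * (W (p i.+1) - W (p i)) + x / n.+1%:R * (W (p i) - W 0).
    by rewrite -mulrDr addrA subrK.
  rewrite lerD ?IH ?(ltnW ile)// -(pS i); apply: H.
    by rewrite p_ge0 -subr_ge0 pS divr_ge0.
  by rewrite (le_trans _ xL)// p_le.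
by move/(_ n.+1 (leqnn _)); rewrite pn mulrAC.
Qed.

End Calculus.

(** * Integral equations with Lipschitz nonlinearity *)

Section Volterra.
Context {R : realType}.
Local Notation mu := (@lebesgue_measure R).
Implicit Types (a b c d x y : R) (f g h u v w : R -> R).

Lemma lipschitz_continuous (K : R) f :
  (forall r s, `|f r - f s| <= K * `|r - s|) -> continuous f.
Proof.
move=> fK x; apply/cvgrPdist_lt => e e0.
have K0 : 0 < `|K| + 1 by rewrite ltr_wpDl.
near=> t; apply: le_lt_trans (fK _ _) _.
apply: (@le_lt_trans _ _ ((`|K| + 1) * `|x - t|)).
  by rewrite ler_wpM2r// (le_trans (ler_norm _))// lerDl.
rewrite mulrC -ltr_pdivlMr//; near: t.
by apply: cvgr_dist_lt; [exact: cvg_id|rewrite divr_gt0].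
Unshelve. all: by end_near. Qed.

Lemma measurable_lipschitz_comp {a b} (K : R) f u :
  (forall r s, `|f r - f s| <= K * `|r - s|) -> measurable_fun `[a, b] u ->
  measurable_fun `[a, b] (fun t => f (u t)).
Proof.
move=> fK mu_; apply: measurableT_comp => //.
by apply: continuous_measurable_fun; exact: lipschitz_continuous fK.
Qed.

Section LipschitzODE.
Variables (L b1 K : R) (b G F : R -> R).
Hypotheses (L0 : 0 < L) (K0 : 0 < K) (b10 : 0 < b1).
Hypotheses (mb : measurable_fun `[0, L] b)
  (bb1 : forall x, 0 <= x <= L -> `|b x| <= b1).
Hypotheses (sG : sqint 0 L G)
  (FK : forall r s, `|F r - F s| <= K * `|r - s|).

Let iG : integ 0 L G. Proof. exact: sqint_integ. Qed.

Let rhs u t := b t * (F (u t) + G t).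
Let picard := fix picard n : R -> R :=
  if n is n'.+1 then fun x => intR 0 x (rhs (picard n')) else fun=> 0.
Let C := intR 0 L (fun t => b1 * (`|F 0| + `|G t|)).
(** Twice the Lipschitz constant [b1 * K] of [rhs] in u: in the norm weighted by exp(l x) the Picard
    map contracts by 1/2, whence the bound [2 * C] and the differences of order 2^-n. *)
Let l := 2 * b1 * K.

Let l0 : 0 < l. Proof. by rewrite !mulr_gt0. Qed.

Let i0 : integ 0 L (fun t => b1 * (`|F 0| + `|G t|)).
Proof. by apply: integZ; apply: integD; [exact: integ_cst|exact: integ_norm]. Qed.

Let C0 : 0 <= C.
Proof. by apply: intR_ge0 => x _; rewrite mulr_ge0 ?addr_ge0// ltW. Qed.

Let expl0 x : 0 <= x -> 1 <= expR (l * x).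
Proof. by move=> x0; rewrite -expR0 ler_expR mulr_ge0// ltW. Qed.

Let integ_rhs (B : R) u : measurable_fun `[0, L] u ->
  (forall x, 0 <= x <= L -> `|u x| <= B) -> integ 0 L (rhs u).
Proof.
move=> mu_ uB; have mF := measurable_lipschitz_comp _ _ _ FK mu_.
apply: (integ_le (fun t => b1 * (`|F 0| + K * B) + b1 * `|G t|)).
- apply: measurable_funM => //; apply: measurable_funD => //; exact: integ_meas iG.
- by apply: integD; [exact: integ_cst|exact/integZ/integ_norm].
move=> x xL; rewrite normrM -mulrDr ler_pM ?bb1//.
apply: le_trans (ler_normD _ _) _; rewrite lerD2r.
have -> : F (u x) = F 0 + (F (u x) - F 0) by rewrite addrC subrK.
apply: le_trans (ler_normD _ _) _; rewrite lerD2l.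
by apply: le_trans (FK _ _) _; rewrite subr0 ler_pM2l// uB.
Qed.

Let picard_bound n : measurable_fun `[0, L] (picard n) /\
  forall x, 0 <= x <= L -> `|picard n x| <= 2 * C * expR (l * x).
Proof.
elim: n => [|n [mn bn]].
  split; first exact: measurable_cst.
  by move=> x _; rewrite /= normr0 !mulr_ge0 ?expR_ge0.
have bn' x : 0 <= x <= L -> `|picard n x| <= 2 * C * expR (l * L).
  move=> xL; apply: le_trans (bn _ xL) _; have /andP[_ xL'] := xL.
  by rewrite ler_wpM2l ?mulr_ge0// ler_expR ler_pM2l.
have ir := integ_rhs _ _ mn bn'.
split; first by apply: (intR_ext_measurable _ _ ir (ltW L0)).
move=> x xL; have /andP[x0 xL'] := xL.
have irx : integ 0 x (rhs (picard n)) := integ_sub ir (lexx _) xL'.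
apply: le_trans (intR_norm irx) _.
have i1 : integ 0 x (fun t => b1 * (`|F 0| + `|G t|)) := integ_sub i0 (lexx _) xL'.
have i2 : integ 0 x (fun t => b1 * K * `|picard n t|).
  apply/integZ/integ_norm/(integ_sub _ (lexx _) xL').
  exact: (integ_bdd _ mn bn').
apply: (@le_trans _ _ (intR 0 x (fun t => b1 * (`|F 0| + `|G t|) +
    b1 * K * `|picard n t|))).
  apply: intR_le; [exact: integ_norm|exact: integD|].
  move=> t /andP[t0 tx]; rewrite /rhs normrM -mulrA -mulrDr ler_pM//.
    by rewrite bb1// t0 (le_trans tx).
  have -> : F (picard n t) = F 0 + (F (picard n t) - F 0) by rewrite addrC subrK.
  apply: le_trans (ler_normD _ _) _; rewrite addrAC lerD2r.
  apply: le_trans (ler_normD _ _) _; rewrite lerD2l.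
  by apply: le_trans (FK _ _) _; rewrite subr0.
rewrite intRD//.
have H1 : intR 0 x (fun t => b1 * (`|F 0| + `|G t|)) <= C.
  by apply: intR_incr => // t _; rewrite mulr_ge0 ?addr_ge0// ltW.
have H2 : intR 0 x (fun t => b1 * K * `|picard n t|) <=
    b1 * K * (2 * C) / l * expR (l * x).
  apply: volterra_weight => //; first by rewrite !mulr_ge0// ltW.
  move=> t /andP[t0 tx]; rewrite -[leRHS]mulrA ler_wpM2l ?mulr_ge0 ?(ltW b10) ?(ltW K0)//.
  by rewrite bn// t0 (le_trans tx).
apply: le_trans (lerD H1 H2) _.
have -> : b1 * K * (2 * C) / l = C by rewrite /l; field; rewrite !gt_eqF.
by have := ler_wpM2l C0 (expl0 _ x0); rewrite mulr1; lra.
Qed.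

Let B := 2 * C * expR (l * L).

Let picard_B n x : 0 <= x <= L -> `|picard n x| <= B.
Proof.
move=> xL; apply: le_trans ((picard_bound n).2 _ xL) _; have /andP[_ xL'] := xL.
by rewrite ler_wpM2l ?mulr_ge0// ler_expR ler_pM2l.
Qed.

Let picard_int n : integ 0 L (rhs (picard n)).
Proof. exact: (integ_rhs B _ (picard_bound n).1 (picard_B n)). Qed.

Let picard_diff n x : 0 <= x <= L ->
  `|picard n.+1 x - picard n x| <= 2 * C / 2 ^+ n * expR (l * x).
Proof.
elim: n x => [|n IH] x xL.
  by rewrite [picard 0 x]/= subr0 expr0 divr1; exact: (picard_bound 1).2.
have /andP[x0 xL'] := xL.
have ir m : integ 0 x (rhs (picard m)) := integ_sub (picard_int m) (lexx _) xL'.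
rewrite [picard n.+2 x]/= [picard n.+1 x]/= -/(picard n.+1) -/(picard n).
rewrite -intRB//; apply: le_trans (intR_norm (integB (ir _) (ir _))) _.
have -> : 2 * C / 2 ^+ n.+1 = b1 * K * (2 * C / 2 ^+ n) / l.
  by rewrite /l exprS; field; rewrite expf_neq0 ?(gt_eqF K0) ?(gt_eqF b10).
apply: volterra_weight => //.
- by rewrite !mulr_ge0 ?invr_ge0 ?exprn_ge0// ltW.
- by apply/integ_norm/integB.
move=> t /andP[t0 tx]; have tL : 0 <= t <= L by rewrite t0 (le_trans tx).
rewrite /rhs -mulrBr normrM opprD addrACA subrr addr0 -!mulrA ler_pM ?bb1//.
apply: le_trans (FK _ _) _; rewrite ler_pM2l// !mulrA; exact: IH.
Qed.

Let picard_cvg x : 0 <= x <= L -> cvgn (picard ^~ x).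
Proof.
move=> xL; have -> : picard ^~ x = series (fun n => picard n.+1 x - picard n x).
  apply/funext => n; rewrite seriesEnat/= telescope_sumr//.
  by rewrite [picard 0 x]/= subr0.
apply: normed_cvg; apply: (@series_le_cvg _ _ (geometric B (2^-1))) => //.
- by move=> n /=.
- by move=> n /=; rewrite mulr_ge0 ?exprn_ge0// !mulr_ge0 ?expR_ge0.
- move=> n /=; apply: le_trans (picard_diff n _ xL) _.
  rewrite /B exprVn mulrAC ler_wpM2r ?invr_ge0 ?exprn_ge0// ler_wpM2l ?mulr_ge0//.
  by have /andP[_ xL'] := xL; rewrite ler_expR ler_pM2l.
- by apply: is_cvg_geometric_series; rewrite ger0_norm ?invf_lt1// ltr1n.
Qed.

Theorem lipschitz_ode : exists u : R -> R,
  sqint 0 L (fun t => b t * (F (u t) + G t)) /\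
  forall x, 0 <= x <= L -> u x = intR 0 x (fun t => b t * (F (u t) + G t)).
Proof.
pose u x := limn (picard ^~ x).
have ucv x : 0 <= x <= L -> picard ^~ x @ \oo --> u x by move=> /picard_cvg.
have mu_ : measurable_fun `[0, L] u.
  apply: (@measurable_fun_cvg _ _ _ _ picard) => [n|x]; first exact: (picard_bound n).1.
  by rewrite /= in_itv/=; exact: ucv.
have uB x : 0 <= x <= L -> `|u x| <= B.
  move=> xL; apply: (cvgr_to_le (cvg_norm (ucv _ xL))).
  by apply: nearW => n; exact: picard_B.
have iu := integ_rhs _ _ mu_ uB.
exists u; split.
  apply: (sqintM_bdd b1) => //; apply: sqintD => //.
  have mF := measurable_lipschitz_comp _ _ _ FK mu_.
  apply: (sqint_bdd (`|F 0| + K * B)) => // x xL.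
  have -> : F (u x) = F 0 + (F (u x) - F 0) by rewrite addrC subrK.
  apply: le_trans (ler_normD _ _) _; rewrite lerD2l.
  by apply: le_trans (FK _ _) _; rewrite subr0 ler_pM2l// uB.
move=> x xL; have /andP[x0 xL'] := xL.
apply: (@cvg_unique _ _ (picard n.+1 x @[n --> \oo])) => //.
  by move: (ucv _ xL); rewrite -(cvg_shiftS (picard ^~ x)).
rewrite [X in X @ _]/=.
apply: (@intR_dct _ _ _ _ _ (fun t => b1 * (`|F 0| + K * B) + b1 * `|G t|)).
- move=> n; exact: (meas_sub (integ_meas (picard_int n)) (lexx _) xL').
- exact: (meas_sub (integ_meas iu) (lexx _) xL').
- by apply: integD; [exact: integ_cst|exact/integZ/integ_norm/(integ_sub iG (lexx _) xL')].
- move=> n t /andP[t0 tx]; have tL : 0 <= t <= L by rewrite t0 (le_trans tx).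
  rewrite /rhs normrM -mulrDr ler_pM ?bb1//.
  apply: le_trans (ler_normD _ _) _; rewrite lerD2r.
  have -> : F (picard n t) = F 0 + (F (picard n t) - F 0) by rewrite addrC subrK.
  apply: le_trans (ler_normD _ _) _; rewrite lerD2l.
  by apply: le_trans (FK _ _) _; rewrite subr0 ler_pM2l// picard_B.
apply: aeW => t /andP[t0 tx]; apply: cvgM; first exact: cvg_cst.
apply: cvgD; last exact: cvg_cst.
apply: continuous_cvg; first exact: (lipschitz_continuous _ _ FK).
by apply: ucv; rewrite t0 (le_trans tx).
Qed.

End LipschitzODE.

(** * Chain and product rules along primitives of square-integrable functions *)

Section ChainRule.
Variables (L : R) (u v : R -> R).
Hypotheses (L0 : 0 <= L) (sv : sqint 0 L v)
  (uE : forall x, 0 <= x <= L -> u x = intR 0 x v).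

Let iv : integ 0 L v. Proof. exact: sqint_integ. Qed.

Lemma primitive_measurable : measurable_fun `[0, L] u.
Proof. exact: (intR_ext_measurable _ _ iv L0). Qed.

Lemma primitive_diff x y : 0 <= y <= x -> x <= L -> u x - u y = intR y x v.
Proof.
move=> /andP[y0 yx] xL; have yL := le_trans yx xL.
rewrite !uE ?y0 ?(le_trans y0 yx)// (@intR_chasles _ 0 y x) ?y0//; last first.
  exact: (integ_sub iv (lexx _) xL).
by rewrite addrC addKr.
Qed.

Lemma primitive_osc x y t : 0 <= y <= t -> t <= x -> x <= L ->
  `|u t - u y| <= intR y x (fun t => `|v t|).
Proof.
move=> /andP[y0 yt] tx xL; have tL := le_trans tx xL.
have ivx : integ y x v := integ_sub iv y0 xL.
rewrite primitive_diff ?y0//; apply: le_trans (intR_norm _) _.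
  exact: (integ_sub ivx (lexx _) tx).
by apply: intR_incr => //; exact: integ_norm.
Qed.

Lemma primitive_bound x : 0 <= x <= L -> `|u x| <= intR 0 L (fun t => `|v t|).
Proof.
move=> /andP[x0 xL]; have u0 : u 0 = 0 by rewrite uE ?lexx// intR_pt.
by have := @primitive_osc L 0 x; rewrite lexx x0 u0 subr0; apply; rewrite ?lexx.
Qed.

Lemma lipschitz_comp_integ (K : R) f h :
  (forall r s, `|f r - f s| <= K * `|r - s|) -> sqint 0 L h ->
  sqint 0 L (fun t => f (u t) * h t).
Proof.
move=> fK sh; have mf := measurable_lipschitz_comp _ _ _ fK primitive_measurable.
apply: (sqintM_bdd (`|f 0| + `|K| * intR 0 L (fun t => `|v t|)) mf) => // x xL.
have -> : f (u x) = f 0 + (f (u x) - f 0) by rewrite addrC subrK.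
apply: le_trans (ler_normD _ _) _; rewrite lerD2l.
apply: le_trans (fK _ _) _; rewrite subr0.
apply: (@le_trans _ _ (`|K| * `|u x|)); first by rewrite ler_wpM2r// ler_norm.
by rewrite ler_wpM2l// primitive_bound.
Qed.

(** Over [y, x] the Taylor remainder of [Phi] and the variation of [f (u t)] each contribute at most
    K A^2, where A is the integral of |v|. By Cauchy-Schwarz A^2 is at most x - y times an increment
    of the primitive of v^2, so [const_of_superlinear] applies. The expansion is asked above [lo]
    only, where a primitive started at [lo] behaves well. *)
Lemma chain_rule (lo K : R) (Phi f : R -> R) :
  0 <= K -> (forall x, 0 <= x <= L -> lo <= u x) ->
  (forall r s, `|f r - f s| <= K * `|r - s|) ->
  (forall r s, lo <= r -> lo <= s ->
    `|Phi s - Phi r - f r * (s - r)| <= K * (s - r) ^+ 2) ->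
  forall x, 0 <= x <= L ->
    Phi (u x) - Phi 0 = intR 0 x (fun t => f (u t) * v t).
Proof.
move=> K0 ulo fK PhiK.
have ifv : integ 0 L (fun t => f (u t) * v t).
  exact: (sqint_integ (lipschitz_comp_integ _ _ _ fK sv)).
pose h x := Phi (u x) - intR 0 x (fun t => f (u t) * v t).
suff H : forall x, 0 <= x <= L -> h x = h 0.
  have u0 : u 0 = 0 by rewrite uE ?lexx// intR_pt.
  move=> x /H; rewrite /h intR_pt subr0 u0 => <-.
  by rewrite opprB addrC subrK.
apply: (@const_of_superlinear _ _ _ (fun x => 2 * K * intR 0 x (fun t => v t ^+ 2))).
move=> x y /andP[y0 yx] xL; have yL := le_trans yx xL.
have x0 := le_trans y0 yx.
have ivx : integ y x v := integ_sub iv y0 xL.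
have ifx : integ y x (fun t => f (u t) * v t) := integ_sub ifv y0 xL.
have iv2 : integ 0 x (fun t => v t ^+ 2) := integ_sub sv.2 (lexx _) xL.
rewrite -mulrBr (@intR_chasles _ 0 y x (fun t => v t ^+ 2)) ?y0// (addrC (intR 0 y _)) addrK.
set A := intR y x (fun t => `|v t|).
have A0 : 0 <= A by apply: intR_ge0.
have A2 : A ^+ 2 <= (x - y) * intR y x (fun t => v t ^+ 2).
  rewrite (@intR_eq _ _ _ (fun t => v t ^+ 2) (fun t => `|v t| ^+ 2)).
    by apply: cauchy_schwarz_intR => //; apply: sqint_norm; exact: sqint_sub sv y0 xL.
  by move=> t _; rewrite real_normK// num_real.
have -> : h x - h y = (Phi (u x) - Phi (u y) - f (u y) * (u x - u y)) -
    intR y x (fun t => (f (u t) - f (u y)) * v t).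
  rewrite (@intR_eq _ _ _ (fun t => (f (u t) - f (u y)) * v t)
    (fun t => f (u t) * v t - f (u y) * v t)); last by move=> t _; rewrite mulrBl.
  rewrite intRB ?intRZ//; last exact: integZ.
  rewrite primitive_diff ?y0// /h (@intR_chasles _ 0 y x) ?y0//; first by ring.
  exact: (integ_sub ifv (lexx _) xL).
have H1 : `|Phi (u x) - Phi (u y) - f (u y) * (u x - u y)| <= K * A ^+ 2.
  apply: le_trans (PhiK _ _ _ _) _; try by apply: ulo; rewrite ?y0 ?x0.
  rewrite ler_wpM2l// -[leLHS]real_normK ?num_real// lerXn2r ?nnegrE//.
  by apply: primitive_osc => //; rewrite y0.
have idf : integ y x (fun t => (f (u t) - f (u y)) * v t).
  apply: (integ_eq (fun t => f (u t) * v t - f (u y) * v t)).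
    by apply: integB => //; exact: integZ.
  by move=> t _; rewrite mulrBl.
have H2 : `|intR y x (fun t => (f (u t) - f (u y)) * v t)| <= K * A ^+ 2.
  apply: le_trans (intR_norm idf) _.
  have -> : K * A ^+ 2 = intR y x (fun t => K * A * `|v t|).
    by rewrite intRZ ?expr2 ?mulrA//; exact: integ_norm.
  apply: intR_le; [exact: integ_norm|exact/integZ/integ_norm|].
  move=> t /andP[yt tx]; rewrite normrM ler_wpM2r//.
  apply: le_trans (fK _ _) _; rewrite ler_wpM2l//.
  by apply: primitive_osc => //; rewrite y0.
apply: le_trans (ler_normB _ _) _; apply: le_trans (lerD H1 H2) _.
have := ler_wpM2l K0 A2; lra.
Qed.

Lemma product_rule (M : R) (p q : R -> R) :
  measurable_fun `[0, L] p -> measurable_fun `[0, L] q ->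
  (forall x, 0 <= x <= L -> `|q x| <= M) ->
  (forall x y, 0 <= y <= x -> x <= L -> p x - p y = intR y x q) ->
  forall x, 0 <= x <= L ->
    u x * p x = intR 0 x (fun t => u t * q t + v t * p t).
Proof.
move=> mp mq qM pq.
have iq : integ 0 L q := integ_bdd _ mq qM.
have plip x y : 0 <= y <= x -> x <= L -> `|p x - p y| <= M * (x - y).
  move=> /andP[y0 yx] xL; rewrite pq ?y0//.
  have iqx := integ_sub iq y0 xL.
  apply: le_trans (intR_norm iqx) _; apply: intR_le_bd => //; first exact: integ_norm.
  by move=> t /andP[yt tx]; rewrite qM// (le_trans y0)//= (le_trans tx).
have M0 : 0 <= M by apply: le_trans (qM 0 _); rewrite ?lexx.
have pM x : 0 <= x <= L -> `|p x| <= `|p 0| + M * L.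
  move=> /andP[x0 xL]; have -> : p x = p 0 + (p x - p 0) by rewrite addrC subrK.
  apply: le_trans (ler_normD _ _) _; rewrite lerD2l.
  apply: le_trans (plip _ _ _ _) _; rewrite ?lexx ?x0// subr0.
  by rewrite ler_wpM2l.
have su : sqint 0 L u := sqint_bdd _ primitive_measurable primitive_bound.
have iuq : integ 0 L (fun t => u t * q t).
  by apply: sqint_mul su _; exact: sqint_bdd _ mq qM.
have ivp : integ 0 L (fun t => v t * p t).
  by apply: sqint_mul sv _; exact: sqint_bdd _ mp pM.
have iall := integD iuq ivp.
pose h x := u x * p x - intR 0 x (fun t => u t * q t + v t * p t).
suff H : forall x, 0 <= x <= L -> h x = h 0.
  move=> x /H; rewrite /h intR_pt subr0 [X in _ = X * _]uE ?lexx// intR_pt mul0r.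
  by move/eqP; rewrite subr_eq0 => /eqP.
apply: (@const_of_superlinear _ _ _ (fun x => 2 * M * intR 0 x (fun t => `|v t|))).
move=> x y /andP[y0 yx] xL; have yL := le_trans yx xL.
have x0 := le_trans y0 yx.
have ivx : integ y x v := integ_sub iv y0 xL.
have iqx : integ y x q := integ_sub iq y0 xL.
have iax := integ_sub iall y0 xL.
rewrite -mulrBr (@intR_chasles _ 0 y x (fun t => `|v t|)) ?y0//; last first.
  exact/integ_norm/(integ_sub iv (lexx _) xL).
rewrite (addrC (intR 0 y _)) addrK; set A := intR y x (fun t => `|v t|).
have i1 : integ y x (fun t => p x * v t) := integZ _ ivx.
have i2 : integ y x (fun t => u y * q t) := integZ _ iqx.
have i3 := integB (integD i1 i2) iax.
(* The increment of the product is split as p(x) (u(x) - u(y)) + u(y) (p(x) - p(y)), so [p] is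
   frozen at x and [u] at y. *)
have -> : h x - h y = intR y x (fun t => p x * v t + u y * q t -
    (u t * q t + v t * p t)).
  rewrite intRB//; last exact: integD.
  rewrite intRD// !intRZ// -pq ?y0// -primitive_diff ?y0//.
  rewrite /h (@intR_chasles _ 0 y x) ?y0//; first by ring.
  exact: (integ_sub iall (lexx _) xL).
apply: le_trans (intR_norm i3) _.
apply: (@le_trans _ _ (intR y x (fun t => M * (x - y) * `|v t| + M * A))).
  apply: intR_le; [exact: integ_norm| |].
    by apply: integD; [exact/integZ/integ_norm|exact: integ_cst].
  move=> t /andP[yt tx]; have t0 := le_trans y0 yt; have tL := le_trans tx xL.
  have -> : p x * v t + u y * q t - (u t * q t + v t * p t) =
     (p x - p t) * v t - (u t - u y) * q t by ring.
  apply: le_trans (ler_normB _ _) _; rewrite !normrM lerD//.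
    rewrite ler_wpM2r//; apply: le_trans (plip _ _ _ _) _; rewrite ?t0//.
    by rewrite ler_wpM2l// lerB.
  rewrite mulrC ler_pM// ?qM ?t0//; apply: primitive_osc => //; rewrite y0//.
rewrite intRD; [|exact/integZ/integ_norm|exact: integ_cst].
by rewrite intRZ ?intR_cst//; [rewrite -/A; lra|exact: integ_norm].
Qed.

End ChainRule.

End Volterra.

(** * Inf-convolution and comparison *)

Section Regularisation.
Context {R : realType}.
Local Notation mu := (@lebesgue_measure R).
Implicit Types (a b c d x y : R) (g h u v w : R -> R).

Section InfConvolution.
Variable f : R -> \bar R.
Hypotheses (cf : continuous f) (f_ge0 : forall s, (0 <= f s)%E)
  (f_fin : forall s, s != 0 -> (f s < +oo)%E) (f0 : f 0 = +oo%E).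

(** The point t = 0 is left out: [fine] would turn the value +oo of [f] there into 0 and create a
    false minimum. *)
Definition infconv_set n (s : R) : set R :=
  [set r | exists2 t, t != 0 & r = fine (f t) + n%:R * `|s - t|].

(* Lipschitz minorants increasing to f. *)
Definition infconv n (s : R) : R := inf (infconv_set n s).

Let fine_ge0 s : 0 <= fine (f s).
Proof. exact: fine_ge0. Qed.

Lemma fineK_off0 s : s != 0 -> (fine (f s))%:E = f s.
Proof. by move=> /f_fin fs; rewrite fineK// ge0_fin_numE. Qed.

Let infconv_lb n s : lbound (infconv_set n s) 0.
Proof. by move=> _ [t t0 ->]; rewrite addr_ge0 ?mulr_ge0. Qed.

Let infconv_nonempty n s : infconv_set n s !=set0.
Proof. by exists (fine (f 1) + n%:R * `|s - 1|); exists 1; rewrite ?oner_eq0. Qed.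

Lemma infconv_le n s t : t != 0 -> infconv n s <= fine (f t) + n%:R * `|s - t|.
Proof. by move=> t0; apply: ge_inf; [exists 0; exact: infconv_lb|exists t]. Qed.

Lemma infconv_ge n s (A : R) :
  (forall t, t != 0 -> A <= fine (f t) + n%:R * `|s - t|) -> A <= infconv n s.
Proof. by move=> H; apply: lb_le_inf => // _ [t t0 ->]; exact: H. Qed.

Lemma infconv_ge0 n s : 0 <= infconv n s.
Proof. by apply: infconv_ge => t _; rewrite addr_ge0 ?mulr_ge0. Qed.

Lemma infconv_lipschitz n r s : `|infconv n r - infconv n s| <= n%:R * `|r - s|.
Proof.
have H x y : infconv n x <= infconv n y + n%:R * `|x - y|.
  rewrite -lerBlDr; apply: infconv_ge => t t0; rewrite lerBlDr.
  apply: le_trans (infconv_le n x _ t0) _; rewrite -addrA lerD2l -mulrDr ler_wpM2l//.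
  rewrite [leRHS]addrC.
  have -> : x - t = (x - y) + (y - t) by ring.
  exact: ler_normD.
rewrite ler_distl; apply/andP; split; last exact: H.
by rewrite lerBlDr distrC; exact: H.
Qed.

Lemma infconv_nondecreasing n m s : (n <= m)%N -> infconv n s <= infconv m s.
Proof.
move=> nm; apply: infconv_ge => t t0; apply: le_trans (infconv_le n s _ t0) _.
by rewrite lerD2l ler_wpM2r// ler_nat.
Qed.

Lemma infconv_le_fine n s : s != 0 -> infconv n s <= fine (f s).
Proof. by move=> s0; have := infconv_le n s s s0; rewrite subrr normr0 mulr0 addr0. Qed.

Lemma infconv_lee n s : ((infconv n s)%:E <= f s)%E.
Proof.
have [->|s0] := eqVneq s 0; first by rewrite f0 leey.
by rewrite -fineK_off0// lee_fin infconv_le_fine.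
Qed.

(** Points t close to s have f t > A by continuity; the others are at distance at least e / 2 from
    [s_ n], and the penalty n e / 2 eventually exceeds A. *)
Lemma near_infconv_ge (s_ : nat -> R) s (A : R) : s_ @ \oo --> s ->
  (A%:E < f s)%E -> \forall n \near \oo, A <= infconv n (s_ n).
Proof.
move=> ss As.
have : nbhs s (fun t => A%:E < f t)%E.
  have /= := cf s [set y | A%:E < y]%E; apply.
  by apply: open_nbhs_nbhs; split => //; exact: open_ereal_gt_ereal.
move=> /nbhs_ballP[e /= e0 He].
have e20 : 0 < e / 2 by rewrite divr_gt0.
near=> n.
apply: infconv_ge => t t0.
have sn : `|s - s_ n| < e / 2 by near: n; exact: cvgr_dist_lt.
have [te|te] := ltP `|s - t| e.
  apply: ler_wpDr; first by rewrite mulr_ge0.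
  by rewrite -lee_fin fineK_off0//; apply: ltW; exact: He.
apply: ler_wpDl => //.
have ste : e / 2 <= `|s_ n - t|.
  have : `|s - t| <= `|s - s_ n| + `|s_ n - t|.
    by rewrite -(subrKA (s_ n)) ler_normD.
  lra.
apply: (@le_trans _ _ (n%:R * (e / 2))); last by rewrite ler_wpM2l.
rewrite -ler_pdivrMr//; near: n; exact: nbhs_infty_ger.
Unshelve. all: by end_near. Qed.

(** The argument moves with n because the approximate solutions do; the limit value +oo at s = 0 is
    included. *)
Lemma infconv_cvg (s_ : nat -> R) s : s_ @ \oo --> s ->
  (infconv n (s_ n))%:E @[n --> \oo] --> f s.
Proof.
move=> ss; have := @near_infconv_ge s_ s.
have := f_ge0 s; case fsE : (f s) => [r| |]// _ H; last first.
  by apply/cvgeyPge => A; near=> n; rewrite lee_fin; near: n; apply: H => //; rewrite ltry.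
apply: cvg_EFin; first by near=> n.
apply/cvgrPdist_le => e e0.
have fe : \forall n \near \oo, (f (s_ n) < (r + e)%:E)%E.
  have : nbhs (f s) [set y | y < (r + e)%:E]%E.
    apply: open_nbhs_nbhs; split; first exact: open_ereal_lt_ereal.
    by rewrite fsE /= lte_fin ltrDl.
  by move=> /(cf s) /ss.
near=> n.
rewrite ler_distlC; apply/andP; split.
  by near: n; apply: H => //; rewrite lte_fin ltrBlDr ltrDl.
rewrite -lee_fin; apply: le_trans (infconv_lee _ _) _; apply: ltW.
by near: n.
Unshelve. all: by end_near. Qed.

End InfConvolution.

(** * Comparison of solutions *)

Section Comparison.
Variables (L b1 K : R) (b G F1 F2 u1 u2 : R -> R).
Hypotheses (L0 : 0 <= L) (K0 : 0 < K) (b10 : 0 < b1).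
Hypotheses (bb : forall x, 0 <= x <= L -> 0 <= b x <= b1).
Hypotheses (F1K : forall r s, `|F1 r - F1 s| <= K * `|r - s|)
  (F12 : forall s, F1 s <= F2 s).
Let v1 t := b t * (F1 (u1 t) + G t).
Let v2 t := b t * (F2 (u2 t) + G t).
Hypotheses (sv1 : sqint 0 L v1) (sv2 : sqint 0 L v2)
  (u1E : forall x, 0 <= x <= L -> u1 x = intR 0 x v1)
  (u2E : forall x, 0 <= x <= L -> u2 x = intR 0 x v2).

(* Gronwall for the square of the positive part of u1 - u2. *)
Lemma ode_comparison x : 0 <= x <= L -> u1 x <= u2 x.
Proof.
pose D t := u1 t - u2 t; pose v t := v1 t - v2 t.
have sv : sqint 0 L v by exact: sqintB.
have DE t : 0 <= t <= L -> D t = intR 0 t v.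
  move=> tL; have /andP[_ tL'] := tL.
  by rewrite /D u1E// u2E// /v intRB//; apply: (integ_sub _ (lexx _) tL');
    exact: sqint_integ.
pose p (s : R) := Num.max s 0.
have pE s : (p s = s /\ 0 <= s) \/ (p s = 0 /\ s <= 0).
  by rewrite /p; case: (leP s 0) => H; [right|left; split => //; exact: ltW].
pose f s := 2 * p s.
have fK r s : `|f r - f s| <= 2 * `|r - s|.
  rewrite /f -mulrBr normrM (@ger0_norm _ 2)// ler_pM2l//.
  rewrite ler_norml; apply/andP.
  have := ler_norm (r - s); have := ler_norm (- (r - s)); rewrite normrN.
  by case: (pE r) => -[-> ?]; case: (pE s) => -[-> ?]; split; lra.
(* Unlike the positive part itself, its square has a Lipschitz derivative, [f], as [chain_rule]
   requires. *)
have PhiK r s : `|p s ^+ 2 - p r ^+ 2 - f r * (s - r)| <= 2 * (s - r) ^+ 2.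
  rewrite /f ler_norml; apply/andP.
  have ? := sqr_ge0 r; have ? := sqr_ge0 s; have ? := sqr_ge0 (s - r).
  case: (pE r) => -[-> ?]; case: (pE s) => -[-> ?].
  - by split; nra.
  - by have : r * s <= 0 by [rewrite mulr_ge0_le0]; split; nra.
  - by have : r * s <= 0 by [rewrite mulr_le0_ge0]; split; nra.
  - by split; nra.
pose B := intR 0 L (fun t => `|v t|).
have DB t : 0 <= t <= L -> `|D t| <= B by apply: primitive_bound.
have mD : measurable_fun `[0, L] D by apply: primitive_measurable sv DE.
have chain t : 0 <= t <= L -> p (D t) ^+ 2 = intR 0 t (fun t => f (D t) * v t).
  move=> tL; rewrite -(@chain_rule _ L D v L0 sv DE (- B) 2 (fun s => p s ^+ 2) f)//.
  - by rewrite /p maxxx expr0n subr0.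
  - by move=> y /DB; rewrite ler_norml => /andP[].
have mp : measurable_fun `[0, L] (fun t => p (D t)).
  by apply: measurable_maxr => //; exact: measurable_cst.
have pB t : 0 <= t <= L -> 0 <= p (D t) ^+ 2 <= B ^+ 2.
  move=> /DB; rewrite ler_norml => /andP[B1 B2]; rewrite sqr_ge0/=.
  by case: (pE (D t)) => -[-> ?]; nra.
have mp2 : measurable_fun `[0, L] (fun t => p (D t) ^+ 2) by exact: measurable_funX.
have ip2 : integ 0 L (fun t => p (D t) ^+ 2).
  by apply: (integ_bdd (B ^+ 2)) => // t /pB /andP[t0 tB]; rewrite ger0_norm.
have K20 : 0 < 2 * (K * b1) by rewrite !mulr_gt0.
have H := @gronwall _ L (B ^+ 2) _ (fun t => p (D t) ^+ 2) K20 mp2 pB.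
move=> xL; have : p (D x) ^+ 2 = 0.
  apply: H => // {xL}x xL; have /andP[x0 xL'] := xL.
  rewrite chain// -intRZ; last exact: (integ_sub ip2 (lexx _) xL').
  apply: intR_le.
  - apply: (integ_sub _ (lexx _) xL'); apply: sqint_integ.
    exact: (lipschitz_comp_integ _ _ _ L0 sv DE _ _ _ fK sv).
  - exact/integZ/(integ_sub ip2 (lexx _) xL').
  move=> t /andP[t0 tx]; have tL : 0 <= t <= L by rewrite t0 (le_trans tx).
  have /andP[bt0 bt1] := bb _ tL.
  rewrite /f; case: (pE (D t)) => -[-> Dt]; last by rewrite mulr0 mul0r expr0n mulr0.
  (* Replacing F2 (u2 t) by the smaller F1 (u2 t) can only increase [v t]; the Lipschitz bound of
     [F1] does the rest, [D t] being nonnegative here. *)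
  have vD : v t <= b1 * (K * D t).
    apply: (@le_trans _ _ (b t * (K * D t))); last first.
      by rewrite ler_wpM2r// mulr_ge0// ltW.
    rewrite /v /v1 /v2 -mulrBr ler_wpM2l//.
    have := F1K (u1 t) (u2 t); rewrite -/(D t) (ger0_norm Dt).
    have := ler_norm (F1 (u1 t) - F1 (u2 t)); have := F12 (u2 t); lra.
  rewrite -!mulrA ler_pM2l//; apply: le_trans (ler_wpM2l Dt vD) _.
  by rewrite expr2; rewrite le_eqVlt; apply/orP; left; apply/eqP; ring.
move=> /eqP; rewrite sqrf_eq0 => /eqP p0.
by case: (pE (D x)) => -[]; rewrite p0 /D; lra.
Qed.

End Comparison.

End Regularisation.

(** * Energy estimate *)

Section SingularODE.
Context {R : realType}.
Local Notation mu := (@lebesgue_measure R).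
Implicit Types (a b c d x y : R) (g h u v w : R -> R).

(** Fatou's lemma is applied to the product [l x * l x] in the extended reals, which still sees the
    points where the limit is +oo. Integrability makes these negligible, and only then is [fine]
    harmless. *)
Lemma sqint_fatou {a b} (h_ : nat -> R -> R) (l : R -> \bar R) (E : R) :
  (forall n, sqint a b (h_ n)) -> (forall n x, 0 <= h_ n x) ->
  (forall n, intR a b (fun t => h_ n t ^+ 2) <= E) ->
  (forall x, a <= x <= b -> (h_ n x)%:E @[n --> \oo] --> l x) ->
  {ae mu, forall x, a <= x <= b -> l x \is a fin_num} /\
  sqint a b (fun x => fine (l x)) /\ intR a b (fun t => fine (l t) ^+ 2) <= E.
Proof.
move=> sh h0 hE hl.
have mh_ n : measurable_fun `[a, b] (EFin \o h_ n) by apply/measurable_EFinP; case: (sh n).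
have ml : measurable_fun `[a, b] l.
  apply: (@emeasurable_fun_cvg _ _ _ _ (fun n => EFin \o h_ n)) => [n|x].
    exact: mh_.
  by rewrite /= in_itv/=; exact: hl.
have l0 x : a <= x <= b -> (0 <= l x)%E.
  move=> /hl hlx; apply: (@cvge_to_ge _ _ _ _ _ _ _ hlx).
  by apply: nearW => n; rewrite lee_fin.
have mll : measurable_fun `[a, b] (fun x => l x * l x)%E by exact: emeasurable_funM.
have llE : (\int[mu]_(x in `[a, b]) (l x * l x) <= E%:E)%E.
  rewrite (_ : (\int[mu]_(x in `[a, b]) (l x * l x))%E =
      (\int[mu]_(x in `[a, b]) limn_einf (fun n => (h_ n x ^+ 2)%:E))%E); last first.
    apply: eq_integral => x; rewrite inE/= in_itv/= => xab.
    have ll : (h_ n x ^+ 2)%:E @[n --> \oo] --> (l x * l x)%E.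
      rewrite (_ : (fun n => (h_ n x ^+ 2)%:E) = (fun n => (h_ n x)%:E * (h_ n x)%:E)%E); last first.
        by apply/funext => n; rewrite -EFinM expr2.
      apply: cvgeM; [|exact: hl..].
      by case: (l x) (l0 _ xab) => //=.
    by rewrite (cvg_limn_einf_sup ll).
  apply: (@le_trans _ _ (limn_einf (fun n => \int[mu]_(x in `[a, b]) (h_ n x ^+ 2)%:E)%E)).
    apply: (@fatou _ _ _ mu `[a, b] (measurable_itv _) (fun n x => (h_ n x ^+ 2)%:E)).
      by move=> n; apply/measurable_EFinP; apply: measurable_funX; case: (sh n).
    by move=> n x _; rewrite lee_fin sqr_ge0.
  rewrite limn_einf_lim; apply: lime_le; first exact: is_cvg_einfs.
  apply: nearW => n; apply: (@le_trans _ _ (\int[mu]_(x in `[a, b]) (h_ n x ^+ 2)%:E)%E).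
    by apply: ereal_inf_lbound; exists n => /=.
  rewrite -[leLHS]fineK; first by rewrite lee_fin; exact: hE.
  exact: integrable_fin_num (sh n).2.
have ill : mu.-integrable `[a, b] (fun x => l x * l x)%E.
  apply/integrableP; split => //; apply: le_lt_trans (ltry E).
  apply: le_trans llE; rewrite le_eqVlt; apply/orP; left; apply/eqP; apply: eq_integral => x; rewrite inE/= in_itv/= => xab.
  by rewrite gee0_abs// mule_ge0// l0.
split.
  have := @integrable_ae _ _ _ mu _ (measurable_itv _) _ ill.
  apply: filterS => x H xab; move: H; rewrite /= in_itv/= => /(_ xab).
  by case: (l x) (l0 _ xab).
have mf : measurable_fun `[a, b] (fun x => fine (l x)) by exact: measurableT_comp.
have le2 x : a <= x <= b -> ((fine (l x) ^+ 2)%:E <= l x * l x)%E.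
  move=> xab; have := l0 _ xab; case: (l x) => [r| |]//= _.
  by rewrite expr0n/= mulyy leey.
have i2 : integ a b (fun x => fine (l x) ^+ 2).
  apply: (@le_integrable _ _ _ mu _ _ _ (fun x => l x * l x)%E) => //.
    by apply/measurable_EFinP; exact: measurable_funX.
  move=> x /=; rewrite in_itv/= => xab.
  rewrite (gee0_abs (mule_ge0 (l0 _ xab) (l0 _ xab))) ger0_norm ?sqr_ge0//.
  exact: le2.
split=> //.
rewrite -lee_fin; apply: le_trans llE.
rewrite /intR /Rintegral fineK; last exact: (integrable_fin_num _ i2).
apply: ge0_le_integral => //.
- by move=> x _; rewrite lee_fin sqr_ge0.
- by apply/measurable_EFinP; exact: measurable_funX.
Qed.

(* Vitali-type convergence: the L2 bound controls the tails, (h - k)^+ <= h^2 / k. *)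
Lemma intR_cvg_L2bounded {a b} (E b1 : R) (c : R -> R) (h_ : nat -> R -> R) h :
  a <= b -> 0 <= b1 -> measurable_fun `[a, b] c ->
  (forall x, a <= x <= b -> 0 <= c x <= b1) ->
  (forall n, sqint a b (h_ n)) -> (forall n x, 0 <= h_ n x) ->
  (forall n, intR a b (fun t => h_ n t ^+ 2) <= E) ->
  sqint a b h -> (forall x, 0 <= h x) -> intR a b (fun t => h t ^+ 2) <= E ->
  {ae mu, forall x, a <= x <= b -> h_ ^~ x @ \oo --> h x} ->
  intR a b (fun t => c t * h_ n t) @[n --> \oo] --> intR a b (fun t => c t * h t).
Proof.
move=> ab b10 mc cb sh h_0 h_E hs h0 hE hcv.
have E0 : 0 <= E by apply: le_trans hE; apply: intR_ge0 => t _; rewrite sqr_ge0.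
have cb' x : a <= x <= b -> `|c x| <= b1.
  by move=> /cb /andP[c0 c1]; rewrite ger0_norm.
have tail (k : R) g : 0 < k -> sqint a b g -> (forall x, 0 <= g x) ->
    intR a b (fun t => g t ^+ 2) <= E ->
    `|intR a b (fun t => c t * g t) - intR a b (fun t => c t * Num.min (g t) k)| <=
      b1 * E / k.
  move=> k0 sg g0 gE.
  have smin : sqint a b (fun t => Num.min (g t) k).
    apply: (sqint_bdd k); first by apply: measurable_minr => //; exact: sg.1.
    by move=> x _; rewrite ger0_norm ?ge_min ?lexx ?orbT// le_min g0 ltW.
  have ig := sqint_integ (sqintM_bdd b1 mc cb' sg).
  have im := sqint_integ (sqintM_bdd b1 mc cb' smin).
  rewrite -intRB//; apply: le_trans (intR_norm (integB ig im)) _.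
  have -> : b1 * E / k = b1 / k * E by rewrite mulrAC.
  apply: (@le_trans _ _ (intR a b (fun t => b1 / k * g t ^+ 2))).
    apply: intR_le; [exact/integ_norm/integB|exact: (integZ _ sg.2)|].
    move=> x xab; have /andP[c0 c1] := cb _ xab.
    rewrite -mulrBr normrM (ger0_norm c0) -mulrA ler_pM// mulrC ler_pdivlMr//.
    have := g0 x; case: (leP (g x) k) => gk gx0; first by rewrite subrr normr0 mul0r sqr_ge0.
    by rewrite ger0_norm ?subr_ge0 ?(ltW gk)//; nra.
  rewrite intRZ; last exact: sg.2.
  by rewrite ler_wpM2l// divr_ge0// ltW.
apply/cvgrPdist_le => e e0.
(* At this truncation level each of the two tails is at most e / 4, leaving e / 2 for the truncated
   integrals; the + 1 keeps k positive when b1 E = 0. *)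
pose k := 4 * (b1 * E + 1) / e.
have bE0 : 0 <= b1 * E by exact: mulr_ge0.
have k0 : 0 < k by rewrite /k divr_gt0// mulr_gt0// ltr_wpDl.
have tk : b1 * E / k <= e / 4.
  rewrite ler_pdivrMr// /k; have -> : e / 4 * (4 * (b1 * E + 1) / e) = b1 * E + 1.
    by field; rewrite gt_eqF.
  by rewrite lerDl.
have cmin : continuous (fun y => Num.min y k).
  apply: (@lipschitz_continuous _ 1) => r s; rewrite mul1r ler_norml; apply/andP.
  have := ler_norm (r - s); have := ler_norm (- (r - s)); rewrite normrN.
  by case: (leP r k) => ?; case: (leP s k) => ?; split; lra.
have trunc : intR a b (fun t => c t * Num.min (h_ n t) k) @[n --> \oo] -->
    intR a b (fun t => c t * Num.min (h t) k).
  apply: (@intR_dct _ _ _ _ _ (fun=> b1 * k)).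
  - move=> n; apply: measurable_funM => //; apply: measurable_minr => //.
    exact: (sh n).1.
  - by apply: measurable_funM => //; apply: measurable_minr => //; exact: hs.1.
  - exact: integ_cst.
  - move=> n x xab; rewrite normrM ler_pM ?cb'// ger0_norm ?ge_min ?lexx ?orbT//.
    by rewrite le_min h_0 ltW.
  - apply: filterS hcv => x H /H {}H; apply: cvgM; first exact: cvg_cst.
    exact: (continuous_cvg _ (cmin (h x)) H).
have e20 : 0 < e / 2 by rewrite divr_gt0.
near=> n.
have H : `|intR a b (fun t => c t * Num.min (h t) k) -
    intR a b (fun t => c t * Num.min (h_ n t) k)| < e / 2.
  by near: n; exact: cvgr_dist_lt.
have H1 := tail _ _ k0 hs h0 hE; have H2 := tail _ _ k0 (sh n) (h_0 n) (h_E n).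
move: H H1 H2 tk; rewrite !ler_norml ltr_norml.
move=> /andP[? ?] /andP[? ?] /andP[? ?] ?; apply/andP; split; lra.
Unshelve. all: by end_near. Qed.

Section Energy.
Variables (L b0 b1 K C0 M : R) (b G F u : R -> R).
Hypotheses (L0 : 0 <= L) (K0 : 0 <= K) (b00 : 0 < b0) (C00 : 0 <= C0) (M0 : 0 <= M).
Hypothesis bb : forall x, 0 <= x <= L -> b0 <= b x <= b1.
Hypotheses (FK : forall r s, `|F r - F s| <= K * `|r - s|) (F0 : forall s, 0 <= F s)
  (FM : forall s, 0 <= s -> intR 0 s F <= C0 + M * s).
Let v t := b t * (F (u t) + G t).
Hypotheses (sG : sqint 0 L G) (sv : sqint 0 L v)
  (uE : forall x, 0 <= x <= L -> u x = intR 0 x v).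

(** The Lipschitz constant [K] does not enter, so the bound serves all regularisations at once. The
    final division is by the coefficient b0 / 2 of the square of F(u) left after the Young
    inequalities. *)
Definition energy_bound := (C0 + ((M * b1) ^+ 2 / b0 + (M * b1) ^+ 2) * L +
  (1 + b1 ^+ 2 / b0) * intR 0 L (fun t => G t ^+ 2)) / (b0 / 2).

Lemma sqint_nonlinearity : sqint 0 L (fun t => F (u t)).
Proof.
have := lipschitz_comp_integ _ _ _ L0 sv uE _ _ (fun=> 1) FK.
move=> H; have {}H := H (sqint_bdd `|1| (measurable_cst _) (fun _ _ => lexx _)).
by under eq_fun do rewrite -[F _]mulr1.
Qed.

(* Test the equation against F(u): the term F(u) u' is an exact derivative. *)
Lemma energy_estimate : intR 0 L (fun t => F (u t) ^+ 2) <= energy_bound.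
Proof.
pose A := intR 0 L (fun t => `|v t|).
have A0 : 0 <= A by exact: intR_ge0.
have uA x : 0 <= x <= L -> `|u x| <= A by exact: primitive_bound.
have cF : continuous F := lipschitz_continuous _ _ FK.
have iF x y : integ x y F by exact: integ_cont.
(* The primitive starts at the lower bound -A of [u], since [intR] vanishes on reversed segments;
   [PhiK] holds above -A only. *)
pose Phi s := intR (- A) s F.
have PhiB r s : - A <= r -> r <= s -> Phi s - Phi r = intR r s F.
  by move=> Ar rs; rewrite /Phi (@intR_chasles _ (- A) r s)// ?Ar// addrC addKr.
have quad r s : r <= s -> forall p, p = r \/ p = s ->
    `|intR r s F - F p * (s - r)| <= K * (s - r) ^+ 2.
  move=> rs p prs; rewrite -(intR_cst r s (F p) rs) -intRB//; last exact: integ_cst.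
  have ifp : integ r s (fun t => F t - F p) by apply: integB => //; exact: integ_cst.
  apply: le_trans (intR_norm ifp) _.
  rewrite expr2 mulrA; apply: intR_le_bd => //; first exact: integ_norm.
  move=> x /andP[rx xs]; apply: le_trans (FK _ _) _; rewrite ler_wpM2l//.
  by rewrite ler_norml; apply/andP; case: prs => ->; split; lra.
have PhiK r s : - A <= r -> - A <= s ->
    `|Phi s - Phi r - F r * (s - r)| <= K * (s - r) ^+ 2.
  move=> Ar As; have [rs|sr] := leP r s.
    by rewrite PhiB//; apply: quad => //; left.
  have := quad s r (ltW sr) r (or_intror erefl).
  rewrite -PhiB// ?(ltW sr)// -normrN.
  have -> : - (Phi r - Phi s - F r * (r - s)) = Phi s - Phi r - F r * (s - r) by ring.
  by have -> : (s - r) ^+ 2 = (r - s) ^+ 2 by ring.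
have uL x : 0 <= x <= L -> - A <= u x by move=> /uA; rewrite ler_norml => /andP[].
have LL : 0 <= L <= L by rewrite L0 lexx.
have := @chain_rule _ L u v L0 sv uE (- A) K Phi F K0 uL FK PhiK L LL.
(* For u L >= 0 this is [FM] with u L <= A; for u L < 0 the left side is nonpositive because F >= 0.
   As A depends on the solution, the next inequality carries M |v| on its left, whose integral
   cancels M A. *)
have PhiL : Phi (u L) - Phi 0 <= C0 + M * A.
  have A0' : - A <= 0 by rewrite oppr_le0.
  have [uL0|uL0] := leP 0 (u L).
    rewrite PhiB//; apply: le_trans (FM _ uL0) _; rewrite lerD2l ler_wpM2l//.
    by apply: le_trans (uA _ LL); exact: ler_norm.
  apply: (@le_trans _ _ 0); last by rewrite addr_ge0// mulr_ge0.
  by rewrite -opprB oppr_le0 PhiB ?(ltW uL0) ?uL//; exact: intR_ge0.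
move=> chain; rewrite chain in PhiL.
set H := intR _ _ _.
have [_ ih2] := sqint_nonlinearity.
have iFv : integ 0 L (fun t => F (u t) * v t) := sqint_mul sqint_nonlinearity sv.
have iv := sqint_integ sv.
have b10 : 0 <= b1.
  by have /andP[h1 h2] := bb _ LL; exact: le_trans (ltW b00) (le_trans h1 h2).
pose c1 := (M * b1) ^+ 2 / b0 + (M * b1) ^+ 2.
pose c2 := 1 + b1 ^+ 2 / b0.
have i1 : integ 0 L (fun t => b0 / 2 * F (u t) ^+ 2 + M * `|v t|).
  by apply: integD; [exact: integZ|exact/integZ/integ_norm].
have i2 : integ 0 L (fun t => c1 + c2 * G t ^+ 2).
  by apply: integD; [exact: integ_cst|apply: integZ; exact: sG.2].
have : intR 0 L (fun t => b0 / 2 * F (u t) ^+ 2 + M * `|v t|) <=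
    intR 0 L (fun t => F (u t) * v t + (c1 + c2 * G t ^+ 2)).
  apply: intR_le => //; first exact: integD.
  move=> t tL; have /andP[bt0 bt1] := bb _ tL.
  have bt00 : 0 <= b t := le_trans (ltW b00) bt0.
  rewrite /v normrM (@ger0_norm _ (b t))//.
  set h := F (u t); have hge0 : 0 <= h by exact: F0.
  set g := `|G t|; have gge0 : 0 <= g by exact: normr_ge0.
  have -> : G t ^+ 2 = g ^+ 2 by rewrite real_normK// num_real.
  have hg : `|h + G t| <= h + g.
    by apply: le_trans (ler_normD _ _) _; rewrite (ger0_norm hge0).
  have Gg : - g <= G t by rewrite lerNl /g -normrN ler_norm.
  (* Young's inequality with weights chosen so that [Q1] and [Q3] each spend b0 / 4 of the available
     b0 h^2, leaving b0 / 2. *)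
  have Q1 : M * b1 * h <= b0 / 4 * h ^+ 2 + (M * b1) ^+ 2 / b0.
    rewrite -(ler_pM2l b00) mulrDr (mulrC b0 (_ / b0)) divfK ?gt_eqF//.
    by have := sqr_ge0 (b0 / 2 * h - M * b1); lra.
  have Q2 : M * b1 * g <= (M * b1) ^+ 2 + g ^+ 2.
    have ? := sqr_ge0 (M * b1 - g); have ? := sqr_ge0 (M * b1); have ? := sqr_ge0 g.
    lra.
  have Q3 : b1 * h * g <= b0 / 4 * h ^+ 2 + b1 ^+ 2 / b0 * g ^+ 2.
    rewrite -(ler_pM2l b00) mulrDr.
    have -> : b0 * (b1 ^+ 2 / b0 * g ^+ 2) = b1 ^+ 2 * g ^+ 2 by field; rewrite gt_eqF.
    by have := sqr_ge0 (b0 / 2 * h - b1 * g); lra.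
  have P1 : M * (b t * `|h + G t|) <= M * b1 * h + M * b1 * g.
    by rewrite -mulrDr -mulrA ler_wpM2l// ler_pM.
  have P2 : b0 * h ^+ 2 <= b t * h ^+ 2 by rewrite ler_wpM2r ?sqr_ge0.
  have P3 : - (b1 * h * g) <= b t * h * G t.
    apply: (@le_trans _ _ (- (b t * h * g))).
      by rewrite lerN2 ler_wpM2r// ler_wpM2r.
    by rewrite -mulrN ler_wpM2l// mulr_ge0.
  have -> : h * (b t * (h + G t)) = b t * h ^+ 2 + b t * h * G t by ring.
  rewrite /c1 /c2; lra.
rewrite intRD; [|exact: integZ|exact/integZ/integ_norm].
rewrite !intRZ//; last exact: integ_norm.
rewrite -/A -/H intRD// intRD; [|exact: integ_cst|apply: integZ; exact: sG.2].
rewrite intR_cst// subr0 intRZ; last exact: sG.2.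
rewrite /energy_bound ler_pdivlMr; last by rewrite divr_gt0.
rewrite -/c1 -/c2 => ?; lra.
Qed.

Lemma energy_sup_bound (E : R) x : intR 0 L (fun t => F (u t) ^+ 2) <= E ->
  0 <= x <= L -> `|u x| <= b1 * (L + E + intR 0 L (fun t => `|G t|)).
Proof.
move=> HE xL; apply: (@le_trans _ _ (intR 0 L (fun t => `|v t|))).
  exact: primitive_bound.
have [_ ih2] := sqint_nonlinearity.
have iG := integ_norm (sqint_integ sG).
have LL : 0 <= L <= L by rewrite L0 lexx.
have b10 : 0 <= b1.
  by have /andP[h1 h2] := bb _ LL; exact: le_trans (ltW b00) (le_trans h1 h2).
have i1 : integ 0 L (fun t => 1 + F (u t) ^+ 2) by apply: integD => //; exact: integ_cst.
apply: (@le_trans _ _ (intR 0 L (fun t => b1 * (1 + F (u t) ^+ 2 + `|G t|)))).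
  apply: intR_le; [exact/integ_norm/sqint_integ|exact/integZ/integD|].
  move=> t tL; have /andP[bt0 bt1] := bb _ tL.
  have bt00 : 0 <= b t := le_trans (ltW b00) bt0.
  rewrite /v normrM (@ger0_norm _ (b t))//.
  rewrite ler_pM//.
  apply: le_trans (ler_normD _ _) _; rewrite lerD2r ger0_norm//.
  have := sqr_ge0 (F (u t) - 1); have := F0 (u t); nra.
rewrite intRZ; last exact: integD.
rewrite ler_wpM2l// intRD// lerD2r intRD//; last exact: integ_cst.
by rewrite intR_cst// subr0 mul1r lerD2l.
Qed.

End Energy.

End SingularODE.

(** * The singular equation *)

Section SingularLimit.
Context {R : realType}.
Local Notation mu := (@lebesgue_measure R).
Implicit Types (a b c d x y : R) (g h u v w : R -> R).

Variables (L b0 b1 C0 M : R) (b G : R -> R) (f : R -> \bar R).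
Hypotheses (L0 : 0 < L) (b00 : 0 < b0) (C00 : 0 <= C0) (M0 : 0 <= M).
Hypotheses (mb : measurable_fun `[0, L] b)
  (bb : forall x, 0 <= x <= L -> b0 <= b x <= b1) (sG : sqint 0 L G).
Hypotheses (cf : continuous f) (f_ge0 : forall s, (0 <= f s)%E)
  (f_fin : forall s, s != 0 -> (f s < +oo)%E) (f0 : f 0 = +oo%E).
Hypothesis fM : forall F : R -> R, continuous F -> (forall s, 0 <= F s) ->
  (forall s, ((F s)%:E <= f s)%E) -> forall s, 0 <= s -> intR 0 s F <= C0 + M * s.

Let b10 : 0 < b1.
Proof.
have /andP[h1 h2] : b0 <= b 0 <= b1 by apply: bb; rewrite lexx ltW.
exact: lt_le_trans b00 (le_trans h1 h2).
Qed.

Let bb1 x : 0 <= x <= L -> `|b x| <= b1.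
Proof.
move=> /bb /andP[h1 h2]; rewrite ger0_norm//; exact: le_trans (ltW b00) h1.
Qed.

Let lipschitz_minorants : exists F : nat -> R -> R,
  [/\ forall n r s, `|F n r - F n s| <= n.+1%:R * `|r - s|,
      forall n s, 0 <= F n s, forall n s, ((F n s)%:E <= f s)%E,
      forall n m s, (n <= m)%N -> F n s <= F m s &
      forall (s_ : nat -> R) s, s_ @ \oo --> s ->
        (F n (s_ n))%:E @[n --> \oo] --> f s].
Proof.
(* The shift makes every Lipschitz constant positive, as [lipschitz_ode] and [ode_comparison]
   require. *)
exists (fun n => infconv f n.+1); split.
- by move=> n r s; exact: infconv_lipschitz.
- by move=> n s; exact: infconv_ge0.
- by move=> n s; exact: infconv_lee.
- by move=> n m s nm; exact: infconv_nondecreasing.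
move=> s_ s ss; have s1 : (fun n => s_ n.-1) @ \oo --> s.
  by rewrite -(cvg_shiftS (fun n => s_ n.-1)).
have := @infconv_cvg _ f cf f_ge0 f_fin f0 _ _ s1.
by rewrite -(cvg_shiftS (fun n => (infconv f n (s_ n.-1))%:E)).
Qed.

(** In the integral equation [fine] differs from [f] only on the null set left by the first clause.
    The solution starts at 0, where [f] is infinite. *)
Theorem singular_ode : exists u : R -> R,
  [/\ {ae mu, forall x, 0 <= x <= L -> f (u x) \is a fin_num},
      sqint 0 L (fun t => fine (f (u t))) &
      forall x, 0 <= x <= L ->
        u x = intR 0 x (fun t => b t * (fine (f (u t)) + G t))].
Proof.
have [F [FK F0 Ff Fnd Fcvg]] := lipschitz_minorants.
have FM n s : 0 <= s -> intR 0 s (F n) <= C0 + M * s.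
  by apply: fM => //; exact: lipschitz_continuous (FK n).
have U_exists n : exists u : R -> R, sqint 0 L (fun t => b t * (F n (u t) + G t)) /\
    forall x, 0 <= x <= L -> u x = intR 0 x (fun t => b t * (F n (u t) + G t)).
  exact: (@lipschitz_ode _ L b1 n.+1%:R).
have [U /all_and2[sV UE]] := choice U_exists.
have K0 n : 0 <= n.+1%:R :> R by [].
pose E := energy_bound L b0 b1 C0 M G.
have U_energy n : intR 0 L (fun t => F n (U n t) ^+ 2) <= E.
  exact: (@energy_estimate _ L b0 b1 n.+1%:R C0 M b G (F n) (U n) (ltW L0) (K0 n)
    b00 C00 M0 bb (FK n) (F0 n) (FM n) sG (sV n) (UE n)).
have sF n : sqint 0 L (fun t => F n (U n t)).
  exact: (@sqint_nonlinearity _ L n.+1%:R b G (F n) (U n) (ltW L0) (FK n) (sV n) (UE n)).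
have bb0 t : 0 <= t <= L -> 0 <= b t <= b1.
  by move=> /bb /andP[h1 h2]; rewrite h2 andbT (le_trans (ltW b00)).
have U_mono x n m : 0 <= x <= L -> (n <= m)%N -> U n x <= U m x.
  move=> xL nm.
  exact: (@ode_comparison _ L b1 n.+1%:R b G (F n) (F m) (U n) (U m) (ltW L0) (ltr0Sn _ _)
    b10 bb0 (FK n) (fun s => Fnd n m s nm) (sV n) (sV m) (UE n) (UE m)).
pose B := b1 * (L + E + intR 0 L (fun t => `|G t|)).
have UB n x : 0 <= x <= L -> `|U n x| <= B.
  exact: (@energy_sup_bound _ L b0 b1 n.+1%:R b G (F n) (U n) (ltW L0)
    b00 bb (FK n) (F0 n) sG (sV n) (UE n) _ _ (U_energy n)).
pose u x := limn (U ^~ x).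
have ucv x : 0 <= x <= L -> U ^~ x @ \oo --> u x.
  move=> xL; apply: nondecreasing_is_cvgn; first by move=> n m nm; exact: U_mono.
  by exists B => _ [n _ <-]; apply: le_trans (UB n _ xL); exact: ler_norm.
have Fcv x : 0 <= x <= L -> (F n (U n x))%:E @[n --> \oo] --> f (u x).
  by move=> /ucv; exact: Fcvg.
have [fin_ae [sf fE]] := @sqint_fatou _ 0 L (fun n t => F n (U n t)) (fun x => f (u x)) E
  sF (fun n x => F0 n _) U_energy Fcv.
exists u; split=> // x xL; have /andP[x0 xL'] := xL.
have sub g : sqint 0 L g -> sqint 0 x g by move=> sg; exact: sqint_sub sg (lexx _) xL'.
have mb' : measurable_fun `[0, x] b := meas_sub mb (lexx _) xL'.
have bb1' t : 0 <= t <= x -> `|b t| <= b1.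
  by move=> /andP[t0 tx]; apply: bb1; rewrite t0 (le_trans tx).
have lim : intR 0 x (fun t => b t * F n (U n t)) @[n --> \oo] -->
    intR 0 x (fun t => b t * fine (f (u t))).
  apply: (@intR_cvg_L2bounded _ _ _ E b1) => //.
  - exact: ltW.
  - move=> t tx; have := bb1' _ tx; have /andP[t0 tx'] := tx.
    have /andP[h1 h2] : b0 <= b t <= b1 by apply: bb; rewrite t0 (le_trans tx').
    by rewrite h2 (le_trans (ltW b00)).
  - by move=> n; exact: sub.
  - move=> n; apply: le_trans (U_energy n).
    by apply: intR_incr => //; [exact: (sF n).2|move=> t _; rewrite sqr_ge0].
  - exact: sub.
  - by move=> t; exact: fine_ge0.
  - apply: le_trans fE.
    by apply: intR_incr => //; [exact: sf.2|move=> t _; rewrite sqr_ge0].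
  - apply: filterS fin_ae => t H /andP[t0 tx].
    have tL : 0 <= t <= L by rewrite t0 (le_trans tx).
    have := Fcv _ tL; rewrite -[f (u t)]fineK ?H// => /fine_cvg; exact.
have split_int g : sqint 0 L g -> intR 0 x (fun t => b t * (g t + G t)) =
    intR 0 x (fun t => b t * g t) + intR 0 x (fun t => b t * G t).
  move=> sg; rewrite -intRD.
  - by apply: intR_eq => t _; rewrite mulrDr.
  - by apply: sqint_integ; apply: (sqintM_bdd b1) => //; exact: sub.
  - by apply: sqint_integ; apply: (sqintM_bdd b1) => //; exact: sub.
apply: (@cvg_unique _ _ (U n x @[n --> \oo])) => //; first exact: ucv.
rewrite split_int// (_ : U ^~ x = fun n => intR 0 x (fun t => b t * F n (U n t)) +
  intR 0 x (fun t => b t * G t)).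
  by apply: cvgD => //; exact: cvg_cst.
by apply/funext => n; rewrite UE// split_int.
Qed.

End SingularLimit.

(** * Smooth functions *)

Section SmoothFunctions.
Context {R : realType}.
Implicit Types (f g : R -> R) (x c s : R).

(** The powers of 1/x are carried along because the derivative of x^-n exp(-1/x) is a combination of
    two members of the same family. *)
Definition flat n x : R := if 0 < x then x^-1 ^+ n * expR (- x^-1) else 0.

Lemma flat_ge0 n x : 0 <= flat n x.
Proof.
rewrite /flat; case: ltP => // x0.
by rewrite mulr_ge0 ?expR_ge0// exprn_ge0// invr_ge0 ltW.
Qed.

Lemma flat_gt0 n x : 0 < x -> 0 < flat n x.
Proof. by move=> x0; rewrite /flat x0 mulr_gt0 ?expR_gt0// exprn_gt0// invr_gt0. Qed.

Lemma flat_le0 n x : x <= 0 -> flat n x = 0.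
Proof. by rewrite /flat ltNge => ->. Qed.

(** From exp y >= y^(n+1) / (n+1)! at y = 1/x. Since flat n h / h = flat (n+1) h for h > 0, this
    makes the difference quotient of [flat n] at 0 tend to 0. *)
Lemma flat_bound n x : 0 < x -> flat n x <= n.+1`!%:R * x.
Proof.
move=> x0; rewrite /flat x0; set y := x^-1; have y0 : 0 < y by rewrite invr_gt0.
rewrite expRN ler_pdivrMr ?expR_gt0//.
have := @expR_ge1Dxn R y n (ltW y0) => H.
have f0 : (0 : R) < n.+1`!%:R by rewrite ltr0n fact_gt0.
have -> : x = y^-1 by rewrite /y invrK.
apply: (@le_trans _ _ (n.+1`!%:R / y * (y ^+ n.+1 / n.+1`!%:R))).
  by rewrite exprS le_eqVlt; apply/orP; left; apply/eqP; field; rewrite !gt_eqF.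
rewrite ler_wpM2l ?divr_ge0// ?(ltW y0)//; apply: le_trans H; by rewrite lerDr.
Qed.

Lemma is_derive_flat n x :
  is_derive x 1 (flat n) (- n%:R * flat n.+1 x + flat n.+2 x).
Proof.
have [x0|x0|->] := ltgtP x 0.
- rewrite !flat_le0 ?(ltW x0)// mulr0 addr0.
  apply: (near_eq_is_derive _ (is_derive_cst (0 : R) x (1 : R))).
  near=> y; rewrite flat_le0//; near: y.
  by apply: filterS (lt_nbhsl x0) => z /ltW.
- have xn0 : x != 0 by rewrite gt_eqF.
  have dV : is_derive x 1 (fun y : R => y^-1) (- x^-1 ^+ 2).
    have := @is_deriveV _ (fun y : R => y) x 1 1 xn0 (is_derive_id x 1).
    by rewrite /GRing.scale/= mulr1 exprVn.
  have dX := @is_deriveX _ _ (fun y : R => y^-1) n x 1 _ dV.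
  have dN := @is_deriveN _ _ _ _ x 1 _ dV.
  have dE := @is_derive1_comp _ expR _ x _ _ (is_derive_expR _) dN.
  have dM := @is_deriveM _ _ _ _ x 1 _ _ dX dE.
  have nearE : \near x, (((fun y : R => y^-1) ^+ n) * (expR \o - (fun y : R => y^-1))) x
      = flat n x.
    near=> y; rewrite /flat ifT; last by near: y; exact: lt_nbhsr.
    by rewrite exprfctE.
  apply: (near_eq_is_derive nearE).
  have -> : - n%:R * flat n.+1 x + flat n.+2 x =
      x^-1 ^+ n * (expR (- x^-1) * - - x^-1 ^+ 2) +
      expR (- x^-1) * (n%:R * x^-1 ^+ n.-1 * - x^-1 ^+ 2).
    rewrite /flat x0 opprK; case: n {dX dM nearE} => [|n].
      by rewrite /= !expr0 mul0r; ring.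
    by rewrite /= !exprS; ring.
  by move: dM; rewrite exprfctE.
- rewrite flat_le0// flat_le0// mulr0 addr0.
  have cv : h^-1 *: ((flat n \o shift 0) (h *: 1) - flat n 0) @[h --> 0^'] --> (0 : R).
    apply/cvgrPdist_le => e e0.
    have f0 : (0 : R) < n.+2`!%:R by rewrite ltr0n fact_gt0.
    near=> h; have hn0 : h != 0 by near: h; exact: nbhs_dnbhs_neq.
    rewrite /= addr0 (flat_le0 n 0)// subr0 sub0r normrN /GRing.scale/= mulr1.
    have [h0|h0] := leP h 0; first by rewrite flat_le0// mulr0 normr0 ltW.
    have -> : h^-1 * flat n h = flat n.+1 h by rewrite /flat h0 exprS mulrA.
    rewrite ger0_norm ?flat_ge0//; apply: le_trans (flat_bound n.+1 _ h0) _.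
    rewrite mulrC -ler_pdivlMr//; near: h; apply: nbhs_dnbhs.
    have ef0 : 0 < e / n.+2`!%:R by rewrite divr_gt0.
    by apply: filterS (lt_nbhsl ef0) => y /ltW.
  apply: DeriveDef; last exact: cvg_lim cv.
  by apply/cvg_ex; exists 0.
Unshelve. all: by end_near. Qed.

(** A syntactic class closed under differentiation: smoothness follows by induction on the order,
    without a formula for higher derivatives. The constructor [smooth_prim] serves test functions
    obtained by integrating another one. *)
Inductive smooth_expr : (R -> R) -> Prop :=
| smooth_cst c : smooth_expr (fun=> c)
| smooth_flat n s c : smooth_expr (fun x => flat n (s * x + c))
| smooth_add f g : smooth_expr f -> smooth_expr g ->
    smooth_expr (fun x => f x + g x)
| smooth_mul f g : smooth_expr f -> smooth_expr g ->
    smooth_expr (fun x => f x * g x)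
| smooth_exp f : smooth_expr f -> smooth_expr (fun x => expR (f x))
| smooth_prim F f : smooth_expr f -> (forall x, is_derive x 1 F (f x)) ->
    smooth_expr F.

Lemma smooth_expr_derive f : smooth_expr f ->
  exists2 g, smooth_expr g & forall x, is_derive x 1 f (g x).
Proof.
elim=> {f} [c|n s c|f g sf [f' sf' df] sg [g' sg' dg]|f g sf [f' sf' df] sg [g' sg' dg]
  |f sf [f' sf' df]|F f sf _ dF].
- by exists (fun=> 0); [exact: smooth_cst|move=> x; exact: is_derive_cst].
- exists (fun x => (- n%:R * flat n.+1 (s * x + c) + flat n.+2 (s * x + c)) * s).
    apply: smooth_mul; last exact: smooth_cst.
    apply: smooth_add; last exact: smooth_flat.
    by apply: smooth_mul; [exact: smooth_cst|exact: smooth_flat].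
  move=> x.
  have H : is_derive x 1 (fun x => s * x + c) s.
    have := is_deriveD (is_deriveZ s (is_derive_id x (1:R))) (is_derive_cst c x 1).
    by rewrite /GRing.scale/= mulr1 addr0.
  exact: (@is_derive1_comp _ (flat n) _ x _ _ (is_derive_flat _ _) H).
- exists (fun x => f' x + g' x); first exact: smooth_add.
  by move=> x; exact: is_deriveD.
- exists (fun x => f x * g' x + g x * f' x).
    by apply: smooth_add; exact: smooth_mul.
  by move=> x; exact: is_deriveM.
- exists (fun x => expR (f x) * f' x); first by apply: smooth_mul => //; exact: smooth_exp.
  by move=> x; exact: (@is_derive1_comp _ expR f x _ _ (is_derive_expR _) (df x)).
- by exists f.
Qed.

Lemma smooth_expr_smooth f : smooth_expr f -> smooth f.
Proof.
move=> sf n x; suff [g sg ->] : exists2 g, smooth_expr g & f^`(n)%classic = g.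
  by have [g' _ dg] := smooth_expr_derive _ sg; exact: (@ex_derive _ _ _ _ _ _ _ (dg x)).
elim: n {x} => [|n [g sg IH]]; first by exists f.
have [g' sg' dg] := smooth_expr_derive _ sg; exists g' => //.
rewrite derive1nS IH; apply/funext => x; rewrite derive1E.
exact: (@derive_val _ _ _ _ _ _ _ (dg x)).
Qed.

Lemma is_derive_continuous f g : (forall x, is_derive x 1 f (g x)) -> continuous f.
Proof.
move=> df x; apply: differentiable_continuous; apply/derivable1_diffP.
exact: (@ex_derive _ _ _ _ _ _ _ (df x)).
Qed.

Lemma smooth_expr_continuous f : smooth_expr f -> continuous f.
Proof. by move=> /smooth_expr_derive[g _ /is_derive_continuous]. Qed.

End SmoothFunctions.

(** * Density of test functions *)

Import HBNNSimple.

Section TestFunctions.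
Context {R : realType}.
Local Notation mu := (@lebesgue_measure R).
Implicit Types (f g h u v w : R -> R) (x c d s : R).
Variable L : R.
Hypothesis L0 : 0 < L.

Definition test_expr (psi : R -> R) := smooth_expr psi /\
  exists c d, [/\ 0 < c, c < d, d < L & forall x, (x < c \/ d < x) -> psi x = 0].

Lemma test_expr_test_fun psi : test_expr psi -> test_fun L psi.
Proof. by move=> [s H]; split => //; exact: smooth_expr_smooth. Qed.

Lemma test_expr0 : test_expr (fun=> 0).
Proof.
split; first exact: smooth_cst.
have L0' := L0.
by exists (L / 3), (2 * L / 3); split => //; lra.
Qed.

Lemma test_exprD f g : test_expr f -> test_expr g -> test_expr (fun x => f x + g x).
Proof.
move=> [sf [c [d [c0 cd dL fE]]]] [sg [c' [d' [c0' cd' dL' gE]]]].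
split; first exact: smooth_add.
exists (Num.min c c'), (Num.max d d'); split.
- by rewrite lt_min c0.
- by rewrite gt_min !lt_max cd.
- by rewrite gt_max dL.
move=> x; rewrite lt_min gt_max => H.
by rewrite fE ?gE ?addr0//; case: H => /andP[]; [left|right|left|right].
Qed.

Lemma test_exprZ (k : R) f : test_expr f -> test_expr (fun x => k * f x).
Proof.
move=> [sf [c [d [c0 cd dL fE]]]].
split; first by apply: smooth_mul => //; exact: smooth_cst.
by exists c, d; split => // x /fE ->; rewrite mulr0.
Qed.

Lemma test_expr_continuous f : test_expr f -> continuous f.
Proof. by move=> [/smooth_expr_continuous]. Qed.

Lemma test_expr_sqint f : test_expr f -> sqint 0 L f.
Proof.
move=> /test_expr_continuous cf; split.
  by apply: measurable_funTS; exact: continuous_measurable_fun.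
by apply: integ_cont => x; apply: cvgM; exact: cf.
Qed.

(** The affine arguments are spelled s * x + c to match [smooth_flat]. *)
Definition bump (p q : R) x := flat 0 (1 * x + - p) * flat 0 (-1 * x + q).

Lemma bump_ge0 p q x : 0 <= bump p q x.
Proof. by rewrite mulr_ge0 ?flat_ge0. Qed.

Lemma bump_gt0 p q x : p < x < q -> 0 < bump p q x.
Proof. by move=> /andP[px xq]; rewrite mulr_gt0// flat_gt0//; lra. Qed.

Lemma bump_out p q x : x <= p \/ q <= x -> bump p q x = 0.
Proof.
by rewrite /bump => -[H|H]; [rewrite (flat_le0 0 (1 * x - p)) ?mul0r|
  rewrite (flat_le0 0 (-1 * x + q)) ?mulr0]; lra.
Qed.

Lemma test_expr_bump p q : 0 < p -> p < q -> q < L -> test_expr (bump p q).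
Proof.
move=> p0 pq qL; split; first by apply: smooth_mul; exact: smooth_flat.
by exists p, q; split => // x [H|H]; rewrite bump_out//; [left|right]; exact: ltW.
Qed.

Definition approximable v := forall e : R, 0 < e ->
  exists2 psi, test_expr psi & intR 0 L (fun x => (psi x - v x) ^+ 2) <= e.

Lemma intR_sq_triangle u v w : sqint 0 L u -> sqint 0 L v -> sqint 0 L w ->
  intR 0 L (fun x => (u x - w x) ^+ 2) <=
  2 * intR 0 L (fun x => (u x - v x) ^+ 2) + 2 * intR 0 L (fun x => (v x - w x) ^+ 2).
Proof.
move=> su sv sw; have [_ uw] := sqintB su sw.
have [_ uv] := sqintB su sv; have [_ vw] := sqintB sv sw.
rewrite -!intRZ// -intRD; [|exact: integZ..].
apply: intR_le => //; first by apply: integD; exact: integZ.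
by move=> x _; have := sqr_ge0 ((u x - v x) - (v x - w x)); lra.
Qed.

Lemma approximable_lim v : sqint 0 L v -> (forall e : R, 0 < e ->
  exists2 w, sqint 0 L w /\ approximable w & intR 0 L (fun x => (w x - v x) ^+ 2) <= e) ->
  approximable v.
Proof.
move=> sv H e e0; have e40 : 0 < e / 4 by rewrite divr_gt0.
have [w [sw aw] wv] := H _ e40; have [psi tpsi pw] := aw _ e40.
exists psi => //; apply: le_trans (intR_sq_triangle _ _ _ (test_expr_sqint _ tpsi) sw sv) _.
lra.
Qed.

Lemma approximableD v w : sqint 0 L v -> sqint 0 L w ->
  approximable v -> approximable w -> approximable (fun x => v x + w x).
Proof.
move=> sv sw av aw e e0; have e40 : 0 < e / 4 by rewrite divr_gt0.
have [f tf fv] := av _ e40; have [g tg gw] := aw _ e40.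
exists (fun x => f x + g x); first exact: test_exprD.
have [_ ifv] := sqintB (test_expr_sqint _ tf) sv.
have [_ igw] := sqintB (test_expr_sqint _ tg) sw.
apply: (@le_trans _ _ (2 * intR 0 L (fun x => (f x - v x) ^+ 2) +
  2 * intR 0 L (fun x => (g x - w x) ^+ 2))); last lra.
rewrite -!intRZ// -intRD; [|exact: integZ..].
apply: intR_le.
- exact: (sqintB (test_expr_sqint _ (test_exprD _ _ tf tg)) (sqintD sv sw)).2.
- by apply: integD; exact: integZ.
by move=> x _; have := sqr_ge0 ((f x - v x) - (g x - w x)); lra.
Qed.

Lemma approximableZ (k : R) v : sqint 0 L v -> approximable v ->
  approximable (fun x => k * v x).
Proof.
move=> sv av e e0; have k10 : 0 < k ^+ 2 + 1 by rewrite ltr_wpDl ?sqr_ge0.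
have [f tf fv] := av _ (divr_gt0 e0 k10).
exists (fun x => k * f x); first exact: test_exprZ.
have [_ ifv] := sqintB (test_expr_sqint _ tf) sv.
have -> : intR 0 L (fun x => (k * f x - k * v x) ^+ 2) =
    k ^+ 2 * intR 0 L (fun x => (f x - v x) ^+ 2).
  by rewrite -intRZ//; apply: intR_eq => x _; ring.
apply: (@le_trans _ _ ((k ^+ 2 + 1) * (e / (k ^+ 2 + 1)))).
  rewrite ler_pM ?sqr_ge0// ?lerDl//; apply: intR_ge0 => x _; exact: sqr_ge0.
by rewrite mulrC divfK// gt_eqF.
Qed.

Lemma approximable_sum (I : Type) (s : seq I) (F : I -> R -> R) :
  (forall i, sqint 0 L (F i)) -> (forall i, approximable (F i)) ->
  sqint 0 L (fun x => \sum_(i <- s) F i x) /\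
  approximable (fun x => \sum_(i <- s) F i x).
Proof.
move=> sF aF; elim: s => [|i s [ss as_]].
  split.
    by under eq_fun do rewrite big_nil; apply: (sqint_bdd 0) => // x _; rewrite normr0.
  move=> e e0; exists (fun=> 0); first exact: test_expr0.
  rewrite (@intR_eq _ _ _ _ (fun=> 0)) ?intR_cst ?mul0r ?ltW//.
  by move=> x _; rewrite big_nil subrr expr0n.
under eq_fun do rewrite big_cons.
by split; [exact: sqintD|exact: approximableD].
Qed.

Lemma sqint_indic (A : set R) : measurable A -> sqint 0 L (\1_A).
Proof.
move=> mA; apply: (sqint_bdd 1); first exact: measurable_indic.
by move=> x _; rewrite indicE; case: (_ \in _); rewrite /= ?normr1 ?normr0.
Qed.

Lemma cvg_sqB0 (u_ : nat -> R) (l : R) : u_ @ \oo --> l ->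
  (u_ n - l) ^+ 2 @[n --> \oo] --> (0 : R).
Proof.
move=> ul; have d0 : (u_ n - l) @[n --> \oo] --> (0 : R).
  by rewrite -(subrr l); apply: cvgB => //; exact: cvg_cst.
rewrite (_ : (fun n => (u_ n - l) ^+ 2) = (fun n => (u_ n - l) * (u_ n - l))).
  by rewrite -[X in _ --> X](mulr0 (0 : R)); exact: (cvgM d0 d0).
by apply/funext => n; rewrite expr2.
Qed.

(* With {B_i > 0} exhausting U, the functions 1 - exp(-n (B_0 + .. + B_(n-1)))
   are test functions converging pointwise to the indicator of U. *)
Lemma approximable_open (U : set R) : open U -> U `<=` `]0, L[ ->
  approximable (\1_U).
Proof.
move=> oU U0L e e0.
(* Enumeration of the bumps over rational segments contained in U; every other code yields the zero
   function. *)
pose B i : R -> R := if choice.unpickle i is Some pq then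
  let p := ratr (pq : rat * rat).1 in let q := ratr pq.2 in
  if asbool (p < q /\ `[p, q] `<=` U) then bump p q else fun=> 0
  else fun=> 0.
have BE i : B i = (fun=> 0) \/ exists p q : R,
    [/\ B i = bump p q, p < q & `[p, q] `<=` U].
  rewrite /B; case: (choice.unpickle i) => [[p q]|]; last by left.
  by case: asboolP => [[pq pqU]|_]; [right; exists (ratr p), (ratr q)|left].
have tB i : test_expr (B i).
  case: (BE i) => [->|[p [q [-> pq pqU]]]]; first exact: test_expr0.
  have := U0L _ (pqU p _); rewrite /= !in_itv/= lexx (ltW pq) => /(_ isT)/andP[p0 _].
  have := U0L _ (pqU q _); rewrite /= !in_itv/= lexx (ltW pq) => /(_ isT)/andP[_ qL].
  exact: test_expr_bump.
have B0 i x : 0 <= B i x.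
  by case: (BE i) => [->//|[p [q [-> _ _]]]]; exact: bump_ge0.
have Bout i x : ~ U x -> B i x = 0.
  case: (BE i) => [->//|[p [q [-> pq pqU]]]] nUx; apply: bump_out.
  have [|px] := leP x p; first by left.
  have [|xq] := leP q x; first by right.
  by exfalso; apply: nUx; apply: pqU; rewrite /= in_itv/= !ltW.
have Bin x : U x -> exists i, 0 < B i x.
  move=> Ux; have /nbhs_ballP[r /= r0 Hr] := open_nbhs_nbhs (conj oU Ux).
  have [p] : exists p : rat, ratr p \in `]x - r, x[ by apply: rat_in_itvoo; rewrite ltrBlDr ltrDl.
  have [q] : exists q : rat, ratr q \in `]x, x + r[ by apply: rat_in_itvoo; rewrite ltrDl.
  rewrite !in_itv/= => /andP[xq qr] /andP[pr px].
  exists (choice.pickle (p, q)); rewrite /B choice.pickleK /=; case: asboolP => [_|[]].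
    by apply: bump_gt0; rewrite px.
  split; first exact: lt_trans xq.
  move=> y /=; rewrite in_itv/= => /andP[py yq]; apply: Hr.
  by rewrite /ball/= ltr_norml; apply/andP; split; lra.
pose S n x := \sum_(i < n) B i x.
have tS n : test_expr (S n).
  rewrite /S; elim: n => [|n IH]; first by under eq_fun do rewrite big_ord0; exact: test_expr0.
  by under eq_fun do rewrite big_ord_recr/=; exact: test_exprD.
have S0 n x : 0 <= S n x by exact: sumr_ge0.
(* A finite sum keeps the support compact, and the factor n drives the exponential to 0 wherever
   some [B i] is positive. The values stay in [0, 1], so dominated convergence applies. *)
pose psi n x := 1 + (-1) * expR (- n%:R * S n x).
have tpsi n : test_expr (psi n).
  have [sS [c [d [c0 cd dL SE]]]] := tS n; split.
    apply: smooth_add; first exact: smooth_cst.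
    apply: smooth_mul; first exact: smooth_cst.
    by apply: smooth_exp; apply: smooth_mul => //; exact: smooth_cst.
  exists c, d; split => // x /SE Sx.
  by rewrite /psi Sx mulr0 expR0 mulN1r subrr.
have psi01 n x : 0 <= psi n x <= 1.
  rewrite /psi mulN1r subr_ge0 gerBl expR_ge0 andbT -[leRHS]expR0 ler_expR.
  by rewrite mulNr oppr_le0 mulr_ge0.
have psicv x : psi n x @[n --> \oo] --> (\1_U x : R).
  have [Ux|nUx] := pselect (U x); last first.
    rewrite indicE memNset//; apply: (@cvg_trans _ (cst 0 @ \oo)); last exact: cvg_cst.
    apply: near_eq_cvg; near=> n; rewrite /psi /S big1 ?mulr0 ?expR0 ?mulN1r ?subrr//.
    by move=> i _; exact: Bout.
  rewrite indicE mem_set//; have [i Bi] := Bin _ Ux.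
  apply/cvgrPdist_le => t t0; near=> n.
  have ni : (i < n)%N by near: n; exact: nbhs_infty_gt.
  have SB : B i x <= S n x.
    by rewrite /S (bigD1 (Ordinal ni))//= lerDl; exact: sumr_ge0.
  rewrite /psi mulN1r opprB addrC subrK ger0_norm ?expR_ge0// mulNr expRN.
  have n0 : (0 : R) < n%:R by rewrite ltr0n (leq_ltn_trans _ ni).
  have nS : 0 < n%:R * S n x by rewrite mulr_gt0// (lt_le_trans Bi).
  apply: (@le_trans _ _ (n%:R * B i x)^-1).
    rewrite lef_pV2 ?posrE ?expR_gt0 ?mulr_gt0//.
    apply: (@le_trans _ _ (1 + n%:R * S n x)); last exact: expR_ge1Dx.
    by rewrite ler_wpDl// ler_pM2l.
  rewrite invfM -ler_pdivlMr ?invr_gt0// invrK -[leRHS]invrK lef_pV2 ?posrE ?invr_gt0 ?mulr_gt0//.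
  by near: n; exact: nbhs_infty_ger.
have mU : measurable U by exact: open_measurable.
have lim : intR 0 L (fun x => (psi n x - \1_U x) ^+ 2) @[n --> \oo] -->
    intR 0 L (fun=> 0).
  apply: (@intR_dct _ _ _ _ _ (fun=> 1)) => //.
  - move=> n; apply: measurable_funX; apply: measurable_funB.
      exact: (test_expr_sqint _ (tpsi n)).1.
    exact: (sqint_indic _ mU).1.
  - exact: integ_cst.
  - move=> n x _; rewrite ger0_norm ?sqr_ge0//; have /andP[? ?] := psi01 n x.
    by rewrite indicE; case: (_ \in _) => /=; nra.
  - apply: aeW => x _.
    exact: cvg_sqB0.
rewrite intR_cst ?mul0r ?ltW// in lim.
have [n _ H] : \forall n \near \oo, intR 0 L (fun x => (psi n x - \1_U x) ^+ 2) <= e.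
  exact: cvgr_le lim _ e0.
by exists (psi n) => //; exact: (H n (leqnn n)).
Unshelve. all: by end_near. Qed.

(** Outer regularity reduces to an open V containing A: the squared difference of the two indicators
    is the indicator of V \ A. *)
Lemma approximable_indic (A : set R) : measurable A -> A `<=` `]0, L[ ->
  approximable (\1_A).
Proof.
move=> mA AL; apply: approximable_lim; first exact: sqint_indic.
move=> e e0.
have muA : (mu A < +oo)%E.
  apply: (@le_lt_trans _ _ (mu `]0, L[)); first by apply: le_measure => //; rewrite inE.
  by rewrite lebesgue_measure_itv/= lte_fin L0 -EFinB ltry.
have [U [oU AU muUA]] := lebesgue_regularity_outer mA muA e0.
pose V := U `&` `]0, L[.
have oV : open V by apply: openI => //; exact: itv_open.
have mV : measurable V by exact: open_measurable.
exists (\1_V).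
  by split; [exact: sqint_indic|apply: approximable_open => // x []].
have mVA : measurable (V `\` A) by exact: measurableD.
rewrite (@intR_eq _ _ _ _ (\1_(V `\` A))); last first.
  move=> x _; rewrite !indicE.
  have [xA|xA] := pselect (A x).
    rewrite (mem_set xA) mem_set; last by split; [exact: AU|exact: AL].
    by rewrite memNset ?subrr ?expr0n//; case.
  rewrite (memNset xA) subr0; have [xV|xV] := pselect (V x).
    by rewrite (mem_set xV) mem_set ?expr1n.
  by rewrite (memNset xV) memNset ?expr0n//; case.
rewrite /intR /Rintegral integral_indic//.
have : (mu ((V `\` A) `&` `[0%R, L]) <= mu (U `\` A))%E.
  apply: le_measure; rewrite ?inE; [exact: measurableI| |by move=> x [[[]]]].
  by apply: measurableD => //; exact: open_measurable.
move=> /le_lt_trans/(_ muUA)/ltW H; rewrite -lee_fin fineK//.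
by rewrite ge0_fin_numE//; exact: le_lt_trans H (ltry _).
Qed.

Lemma ae_neq (c : R) : {ae mu, forall x : R, x != c}.
Proof.
exists [set c]; split => //; first exact: lebesgue_measure_set1.
by move=> x /= /negP; rewrite negbK => /eqP.
Qed.

Lemma approximable_ge0 v : sqint 0 L v -> (forall x, 0 <= v x) -> approximable v.
Proof.
move=> sv v0; apply: approximable_lim => // e e0.
pose D : set R := `]0, L[%classic.
have mD : measurable D by exact: measurable_itv.
have mv : measurable_fun D (EFin \o v).
  apply/measurable_EFinP; apply: measurable_funS sv.1 => // x; rewrite /D/= !in_itv/=.
  by move=> /andP[/ltW -> /ltW ->].
pose s n : R -> R := nnsfun_approx mD mv n.
have ms n : measurable_fun setT (s n) by exact: measurable_funP.
have v0' x : D x -> (0 <= (EFin \o v) x)%E by move=> _; rewrite lee_fin.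
have s_le n x : D x -> s n x <= v x.
  by move=> Dx; rewrite -lee_fin /s nnsfun_approxE; exact: le_approx.
have s_cv x : D x -> s n x @[n --> \oo] --> v x.
  by move=> Dx; exact: fine_cvg (cvg_nnsfun_approx mD mv v0' Dx).
(* The simple function [s n] cut off outside the open interval, because [approximable_indic] needs
   sets inside it; the end points are negligible. *)
pose w n x := \sum_(y <- fset_set (range (s n))) y * \1_(s n @^-1` [set y] `&` D) x.
have mpre n y : measurable (s n @^-1` [set y] `&` D) by
  apply: measurableI => //; rewrite -[X in measurable X]setTI; exact: ms.
have wD n x : D x -> w n x = s n x.
  move=> Dx; rewrite /s (fimfunE (nnsfun_approx mD mv n) x) fsbig_finite//=.
  by apply: eq_bigr => y _; rewrite !indicE in_setI (mem_set Dx) andbT.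
have wN n x : ~ D x -> w n x = 0.
  move=> nDx; rewrite /w big1// => y _.
  by rewrite indicE memNset ?mulr0//; case.
have [sw aw] : (forall n, sqint 0 L (w n)) /\ forall n, approximable (w n).
  by apply: all_and2 => n; apply: approximable_sum => y;
    [exact/sqintZ/sqint_indic|apply: approximableZ; [exact: sqint_indic|
      by apply: approximable_indic => // x []]].
have lim : intR 0 L (fun x => (w n x - v x) ^+ 2) @[n --> \oo] --> intR 0 L (fun=> 0).
  apply: (@intR_dct _ _ _ _ _ (fun x => v x ^+ 2)) => //.
  - by move=> n; apply: measurable_funX; exact: (sqintB (sw n) sv).1.
  - exact: sv.2.
  - move=> n x _; rewrite ger0_norm ?sqr_ge0//; have := v0 x.
    have [Dx|nDx] := pselect (D x); last by rewrite wN// sub0r sqrrN.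
    rewrite wD//; have := s_le n _ Dx; have : 0 <= s n x by rewrite /s; exact: fun_ge0.
    nra.
  - apply: filterS2 (ae_neq 0) (ae_neq L) => x xn0 xnL /andP[x0 xL].
    have Dx : D x by rewrite /D/= in_itv/= !lt_neqAle eq_sym xn0 x0 xnL.
    by apply: cvg_sqB0; under eq_fun do rewrite wD//; exact: s_cv.
rewrite intR_cst ?mul0r ?ltW// in lim.
have [n _ H] : \forall n \near \oo, intR 0 L (fun x => (w n x - v x) ^+ 2) <= e.
  exact: cvgr_le lim _ e0.
by exists (w n) => //; exact: (H n (leqnn n)).
Qed.

Lemma sqint_approximable v : sqint 0 L v -> approximable v.
Proof.
move=> sv.
have smax u : sqint 0 L u -> sqint 0 L (fun x => Num.max (u x) 0).
  move=> [mu_ iu]; have mm : measurable_fun `[0, L] (fun x => Num.max (u x) 0).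
    by apply: measurable_maxr => //; exact: measurable_cst.
  split=> //; apply: (integ_le (fun x => u x ^+ 2)) => //; first exact: measurable_funX.
  move=> x _; rewrite ger0_norm ?sqr_ge0//; case: (ltP (u x) 0) => // _.
  by rewrite expr0n sqr_ge0.
have sv' := sqintZ (-1) sv.
have E : v = fun x => Num.max (v x) 0 + -1 * Num.max (-1 * v x) 0.
  apply/funext => x; rewrite !mulN1r; case: (ltP (v x) 0); case: (ltP (- v x) 0); lra.
rewrite {}E; have sm := smax _ sv; have sm' := smax _ sv'.
have max0 (y : R) : 0 <= Num.max y 0 by rewrite le_max lexx orbT.
apply: approximableD => //; first exact: sqintZ.
  exact: approximable_ge0.
by apply: approximableZ => //; exact: approximable_ge0.
Qed.

(* Correct the mean of an approximation of v by a fixed test function of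
   nonzero mean, then integrate. *)
Lemma H1_density u v : sqint 0 L v -> intR 0 L v = 0 ->
  (forall x, 0 <= x <= L -> u x = intR 0 x v) -> forall e : R, 0 < e ->
  exists psi, [/\ test_fun L psi,
    intR 0 L (fun x => (derive1 psi x - v x) ^+ 2) <= e &
    forall x, 0 <= x <= L -> (psi x - u x) ^+ 2 <= L * e].
Proof.
move=> sv v0 uE e e0.
have s1 : sqint 0 L (fun=> 1) by apply: (sqint_bdd 1) => // x _; rewrite normr1.
(* Squared distance L / 4 from the constant 1 forces (r - L)^2 <= L^2 / 4, so the mean [r] of rho is
   positive. *)
have [rho trho rho1] := sqint_approximable _ s1 _ (divr_gt0 L0 (ltr0n R 4)).
have srho := test_expr_sqint _ trho.
pose r := intR 0 L rho.
have r0 : 0 < r.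
  have := cauchy_schwarz_intR (ltW L0) (sqintB srho s1).
  rewrite intRB; [|exact: sqint_integ..]; rewrite (intR_cst 0 L 1 (ltW L0)) !subr0 mul1r -/r.
  move=> H; have {}H : (r - L) ^+ 2 <= L * (L / 4).
    by apply: le_trans H _; rewrite ler_pM2l.
  rewrite ltNge; apply/negP => r0; have := L0; nra.
(* [k] is the price of the mean correction: since v has integral 0, (intR 0 L eta)^2 <= L I with I
   the squared error of eta, so the correction has squared norm at most k I. The total error is then
   (2 + 2 k) I. *)
pose k := L * intR 0 L (fun x => rho x ^+ 2) / r ^+ 2.
have k0 : 0 <= k.
  rewrite /k divr_ge0 ?sqr_ge0// mulr_ge0 ?(ltW L0)//.
  by apply: intR_ge0 => x _; exact: sqr_ge0.
have e10 : 0 < e / (2 + 2 * k) by rewrite divr_gt0// ltr_wpDr// mulr_ge0.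
have [eta teta etaE] := sqint_approximable _ sv _ e10.
have seta := test_expr_sqint _ teta.
pose m := intR 0 L eta / r.
pose f x := eta x + (- m) * rho x.
have tf : test_expr f by apply: test_exprD => //; exact: test_exprZ.
have sf := test_expr_sqint _ tf.
have cf := test_expr_continuous _ tf.
have f0 : intR 0 L f = 0.
  rewrite /f intRD; [|exact: sqint_integ|exact/integZ/sqint_integ].
  rewrite intRZ; last exact: sqint_integ.
  by rewrite -/r /m mulNr divfK ?gt_eqF// subrr.
have fv : intR 0 L (fun x => (f x - v x) ^+ 2) <= e.
  apply: le_trans (intR_sq_triangle _ _ _ sf seta sv) _.
  have -> : intR 0 L (fun x => (f x - eta x) ^+ 2) =
      m ^+ 2 * intR 0 L (fun x => rho x ^+ 2).
    rewrite -intRZ; last exact: srho.2.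
    by apply: intR_eq => x _; rewrite /f; ring.
  have := cauchy_schwarz_intR (ltW L0) (sqintB seta sv).
  rewrite intRB; [|exact: sqint_integ..]; rewrite v0 !subr0.
  set I := intR 0 L (fun x => (eta x - v x) ^+ 2) in etaE *.
  move=> H; have H2 : m ^+ 2 * intR 0 L (fun x => rho x ^+ 2) <= k * I.
    rewrite /m /k expr_div_n.
    have -> : L * intR 0 L (fun x => rho x ^+ 2) / r ^+ 2 * I =
       (L * I) * (intR 0 L (fun x => rho x ^+ 2) / r ^+ 2) by ring.
    rewrite mulrAC -mulrA ler_wpM2r// divr_ge0 ?sqr_ge0//.
    by apply: intR_ge0 => x _; exact: sqr_ge0.
  apply: (@le_trans _ _ ((2 + 2 * k) * I)); first lra.
  by rewrite mulrC -ler_pdivlMr// ltr_wpDr// mulr_ge0.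
have [_ [c [d [c0 cd dL fE]]]] := tf.
pose psi x := intR 0 x f.
have psi_c x : x < c -> psi x = 0.
  move=> xc; have [x0|x0] := leP 0 x; last exact: intR_gt.
  rewrite /psi (@intR_eq _ _ _ _ (fun=> 0)) ?intR_cst ?mul0r//.
  by move=> y /andP[_ yx]; rewrite fE//; left; exact: le_lt_trans xc.
(* Here the zero mean of [f] is used; to the left of c the primitive vanishes by itself. *)
have psi_d x : d < x -> psi x = 0.
  move=> dx; have tail (p q : R) : d < p -> p <= q -> intR p q f = 0.
    move=> dp pq; rewrite (@intR_eq _ _ _ _ (fun=> 0)) ?intR_cst ?mul0r//.
    by move=> y /andP[py _]; rewrite fE//; right; exact: lt_le_trans py.
  have x0 : 0 <= x by lra.
  have iff p q : integ p q f by exact: integ_cont.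
  have [xL|Lx] := leP x L.
    have := @intR_chasles _ 0 x L f (iff _ _); rewrite x0 xL f0 => /(_ isT).
    by rewrite (tail x L)// addr0 /psi => <-.
  by rewrite /psi (@intR_chasles _ 0 L x)// ?(ltW L0) ?(ltW Lx)// f0 (tail L x)// ?addr0// ltW.
have dpsi x : is_derive x 1 psi (f x).
  have [xc|cx] := ltP x c.
    rewrite fE; last by left.
    apply: (near_eq_is_derive _ (is_derive_cst (0 : R) x (1 : R))).
    near=> y; rewrite psi_c//; near: y; exact: lt_nbhsl.
  have x0 : 0 < x by exact: lt_le_trans cx.
  have := @continuous_FTC1_closed _ f 0 x (x + 1) _ _ x0 (cf x).
  case; [by rewrite ltrDl|exact: integ_cont|].
  by move=> dx fx; apply: (DeriveDef dx); rewrite -derive1E; exact: fx.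
exists psi; split.
- apply: test_expr_test_fun; split; first by apply: smooth_prim dpsi; exact: tf.1.
  exists c, d; split=> // x [|]; [exact: psi_c|exact: psi_d].
- rewrite (@intR_eq _ _ _ _ (fun x => (f x - v x) ^+ 2))// => x _.
  by rewrite derive1E (@derive_val _ _ _ _ _ _ _ (dpsi x)).
move=> x xL; have /andP[x0 xL'] := xL.
have sx g : sqint 0 L g -> sqint 0 x g by move=> sg; exact: sqint_sub sg (lexx _) xL'.
rewrite uE// /psi -intRB; [|exact/sqint_integ/sx..].
apply: le_trans (cauchy_schwarz_intR x0 (sqintB (sx _ sf) (sx _ sv))) _.
rewrite subr0 ler_pM//.
  by apply: intR_ge0 => y _; exact: sqr_ge0.
apply: le_trans fv; apply: intR_incr => //; first exact: (sqintB sf sv).2.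
by move=> y _; exact: sqr_ge0.
Unshelve. all: by end_near. Qed.

End TestFunctions.

(** * Reflection, gluing and weak derivatives *)

Section Reflection.
Context {R : realType}.
Local Notation mu := (@lebesgue_measure R).
Implicit Types (a b c : R) (g h : R -> R).

Let refl c : measurableTypeR R -> measurableTypeR R := fun x => c - (x : R).

Let measurable_refl c : measurable_fun [set: measurableTypeR R] (refl c).
Proof. by apply: measurable_funB => //; exact: measurable_cst. Qed.

Let refl_preimage c a b : refl c @^-1` `[c - b, c - a] = `[a, b]%classic.
Proof.
by apply/seteqP; split => x /=; rewrite /refl !in_itv/= => /andP[? ?]; apply/andP; split; lra.
Qed.

(** By uniqueness it is enough to compare lengths of half-open intervals; reflection moves the
    closed end to the other side. *)
Lemma lebesgue_measure_reflect c (A : set R) : measurable A ->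
  pushforward mu (refl c) A = mu A.
Proof.
move=> mA; have mr := measurable_refl c.
apply/esym/lebesgue_measure_unique => //= _ [[a b]] _ <-.
rewrite /pushforward (_ : _ @^-1` _ = `[c - b, c - a[%classic); last first.
  by apply/seteqP; split => x /=; rewrite /refl !in_itv/= => /andP[? ?]; apply/andP; split; lra.
rewrite !lebesgue_measure_itv/= !lte_fin ltrD2l ltrN2 -!EFinD.
by case: ifP => // _; congr (_%:E); ring.
Qed.

Lemma ge0_integral_reflect c a b (f : R -> \bar R) :
  measurable_fun `[c - b, c - a] f -> (forall x, (0 <= f x)%E) ->
  (\int[mu]_(x in `[(c - b)%R, (c - a)%R]) f x =
   \int[mu]_(x in `[a, b]) f (c - x)%R)%E.
Proof.
move=> mf f0; rewrite -(refl_preimage c a b).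
have mr := measurable_refl c.
rewrite (_ : (fun x => f (c - x)) = f \o refl c)//.
rewrite -(@ge0_integral_pushforward _ _ _ _ _ (refl c) mr _ _ f)//.
by apply: eq_measure_integral => //= A mA _; exact/esym/lebesgue_measure_reflect.
Qed.

Lemma measurable_reflect c a b h : measurable_fun `[c - b, c - a] h ->
  measurable_fun `[a, b] (fun t => h (c - t)).
Proof.
move=> mh; apply: (measurable_comp _ _ mh) => //.
  move=> _ [t /= + <-]; rewrite !in_itv/= => /andP[? ?]; apply/andP; split; lra.
by apply: measurable_funB => //; exact: measurable_cst.
Qed.

Lemma integ_reflect c a b h : integ (c - b) (c - a) h ->
  integ a b (fun t => h (c - t)).
Proof.
move=> ih; have mh := integ_meas ih.
have mr := measurable_reflect _ _ _ _ mh.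
apply/integrableP; split; first exact/measurable_EFinP.
have /integrableP[_] := ih; rewrite (@ge0_integral_reflect c a b)//.
by apply/measurable_EFinP; exact: measurableT_comp.
Qed.

Lemma intR_reflect c a b h : integ (c - b) (c - a) h ->
  intR a b (fun t => h (c - t)) = intR (c - b) (c - a) h.
Proof.
have ge0 k : (forall x, 0 <= k x) -> integ (c - b) (c - a) k ->
    intR a b (fun t => k (c - t)) = intR (c - b) (c - a) k.
  move=> k0 ik; rewrite /intR /Rintegral (@ge0_integral_reflect c a b (EFin \o k))//.
  exact: (measurable_int _ ik).
move=> ih; have in_ := integ_norm ih.
have id := integB in_ ih.
have E := ge0 (fun t => `|h t| - h t).
(* Reduction to the nonnegative functions |h| and |h| - h. *)
have -> : intR (c - b) (c - a) h = intR (c - b) (c - a) (fun t => `|h t|) -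
    intR (c - b) (c - a) (fun t => `|h t| - h t) by rewrite intRB//; ring.
rewrite -ge0// -(ge0 (fun t => `|h t| - h t))//; last first.
  by move=> x; rewrite subr_ge0 ler_norm.
rewrite -intRB; [|exact: (integ_reflect _ _ _ (fun t => `|h t|))|
  exact: (integ_reflect _ _ _ (fun t => `|h t| - h t))].
by apply: intR_eq => x _; ring.
Qed.

Lemma ae_reflect c (P : R -> Prop) : {ae mu, forall x, P x} ->
  {ae mu, forall x, P (c - x)}.
Proof.
move=> [N [mN N0 PN]]; exists (refl c @^-1` N); split.
- by rewrite -[X in measurable X]setTI; apply: measurable_refl.
- by rewrite -N0; exact: lebesgue_measure_reflect.
- by move=> x /= nP; apply: PN.
Qed.

Lemma sqint_reflect c a b h : sqint (c - b) (c - a) h ->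
  sqint a b (fun t => h (c - t)).
Proof.
move=> [mh ih]; split; first exact: measurable_reflect.
exact: (integ_reflect _ _ _ (fun t => h t ^+ 2)).
Qed.

End Reflection.

Section Glue.
Context {R : realType}.
Local Notation mu := (@lebesgue_measure R).
Implicit Types (a b c m : R) (g h : R -> R).

Lemma sqint_le {a b} g h : sqint a b g -> measurable_fun `[a, b] h ->
  (forall x, a <= x <= b -> `|h x| <= g x) -> sqint a b h.
Proof.
move=> [mg ig] mh hg; split=> //; apply: (integ_le _ _ _ ig); first exact: measurable_funX.
move=> x /hg hgx; rewrite normrX lerXn2r// nnegrE// (le_trans _ hgx)//.
Qed.

Lemma measurable_glue {a b} m g h : measurable_fun `[a, b] g ->
  measurable_fun `[a, b] h ->
  measurable_fun `[a, b] (fun t => if t <= m then g t else h t).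
Proof.
move=> mg mh; apply: measurable_fun_if => //.
- by apply: measurable_fun_ler => //; exact: measurable_cst.
- by apply: measurable_funS mg => //; exact: subIsetl.
- by apply: measurable_funS mh => //; exact: subIsetl.
Qed.

Lemma sqint_glue {a b} m g h : sqint a b g -> sqint a b h ->
  sqint a b (fun t => if t <= m then g t else h t).
Proof.
move=> sg sh; apply: (sqint_le (fun t => `|g t| + `|h t|)).
- by apply: sqintD; exact: sqint_norm.
- by apply: measurable_glue; [exact: sg.1|exact: sh.1].
by move=> x _; case: ifP => _; rewrite ?lerDl ?lerDr.
Qed.

Lemma intR_eq_oo {a b} g h : measurable_fun `[a, b] g -> measurable_fun `[a, b] h ->
  (forall x, a < x < b -> g x = h x) -> intR a b g = intR a b h.
Proof.
move=> mg mh gh; rewrite /intR /Rintegral; congr fine.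
have sub : `]a, b[ `<=` `[a, b]%classic.
  by move=> x /=; rewrite !in_itv/= => /andP[/ltW -> /ltW ->].
apply: eq_integral_itv_bounded; [exact: measurable_funS mg|exact: measurable_funS mh|].
by move=> x; rewrite in_itv/= => /gh.
Qed.

(** Equal values at [m] rule out a jump, so the glued function is still a primitive; the reflected
    branch runs backwards, hence the minus sign. *)
Lemma glue_primitive (L m : R) (u1 v1 w v2 : R -> R) : 0 <= m <= L ->
  sqint 0 L v1 -> sqint 0 L v2 ->
  (forall x, 0 <= x <= L -> u1 x = intR 0 x v1) ->
  (forall x, 0 <= x <= L -> w x = intR 0 x v2) ->
  u1 m = w (L - m) ->
  forall x, 0 <= x <= L ->
    (if x <= m then u1 x else w (L - x)) =
    intR 0 x (fun t => if t <= m then v1 t else - v2 (L - t)).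
Proof.
move=> /andP[m0 mL] sv1 sv2 u1E wE um x /andP[x0 xL].
pose v t := if t <= m then v1 t else - v2 (L - t).
case: ifP => [xm|/negbT]; rewrite ?u1E ?x0//.
  by apply: intR_eq => t /andP[t0 tx]; rewrite (le_trans tx xm).
rewrite -ltNge => mx.
have sr : sqint 0 L (fun t => v2 (L - t)) by apply: sqint_reflect; rewrite subrr subr0.
have sr' : sqint 0 L (fun t => - v2 (L - t)).
  by have := sqintZ (-1) sr; under eq_fun do rewrite mulN1r.
have sv : sqint 0 L v := sqint_glue m _ _ sv1 sr'.
rewrite -/v (@intR_chasles _ 0 m x) ?m0 ?(ltW mx)//; last first.
  exact: (integ_sub (sqint_integ sv) (lexx _) xL).
rewrite (@intR_eq _ 0 m v v1); last by move=> t /andP[_ tm]; rewrite /v tm.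
rewrite -u1E ?m0// um.
have sx g : sqint 0 L g -> sqint m x g by move=> sg; exact: sqint_sub sg m0 xL.
(* At t = m the glued derivative takes the value of [v1], so the two integrands agree on the open
   segment only. *)
rewrite (@intR_eq_oo m x v (fun t => -1 * v2 (L - t))); last first.
- by move=> t /andP[mt _]; rewrite /v leNgt mt/= mulN1r.
- exact: (sqintZ (-1) (sx _ sr)).1.
- exact: (sx _ sv).1.
have i2 : integ (L - x) (L - m) v2.
  by apply: (integ_sub (sqint_integ sv2)); lra.
rewrite intRZ; last exact: integ_reflect.
rewrite (intR_reflect _ _ _ _ i2) !wE; [|by apply/andP; split; lra..].
rewrite (@intR_chasles _ 0 (L - x) (L - m)); [by ring| |by apply/andP; split; lra].
by apply: (integ_sub (sqint_integ sv2)); lra.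
Qed.

End Glue.

(** * From primitives to weak derivatives and H^1_0 *)

Section Weak.
Context {R : realType}.
Local Notation mu := (@lebesgue_measure R).
Implicit Types (f g h u v psi : R -> R).
Variable L : R.
Hypothesis L0 : 0 < L.

Let oI_sub : oI L `<=` `[0, L]%classic.
Proof. by move=> x; rewrite /oI/= !in_itv/= => /andP[/ltW -> /ltW ->]. Qed.

Lemma integral_oI h : integ 0 L h ->
  (\int[mu]_(x in oI L) (h x)%:E = (intR 0 L h)%:E)%E.
Proof.
move=> ih; rewrite /intR /Rintegral fineK; last exact: (integrable_fin_num _ ih).
rewrite /oI -(@integral_itv_bndoo _ 0 L (EFin \o h) true false)//.
by apply: measurable_funS (measurable_int _ ih).
Qed.

Lemma sqint_L2 f : sqint 0 L f -> L2 L f.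
Proof.
move=> [mf i2]; split; first exact: measurable_funS mf.
by rewrite (integral_oI (fun x => f x ^+ 2))// ltry.
Qed.

(** [L2] controls [f] on the open interval only, while [sqint] concerns the closed one; extension by
    0 bridges the gap. *)
Lemma L2_sqint f : L2 L f -> sqint 0 L (f \_ (oI L)).
Proof.
move=> [mf i2]; have mfp : measurable_fun setT (f \_ (oI L)).
  by apply/(measurable_restrictT f) => //; exact: measurable_itv.
have mfp' : measurable_fun `[0, L] (f \_ (oI L)) by exact: measurable_funTS.
split=> //; apply/integrableP; split; first by apply/measurable_EFinP; exact: measurable_funX.
rewrite (_ : (\int[mu]_(x in _) _)%E = (\int[mu]_(x in oI L) (f x ^+ 2)%:E)%E)//.
rewrite (@integral_itv_bndoo _ 0 L _ true false); last first.
  apply: measurableT_comp => //; apply/measurable_EFinP; apply: measurable_funX.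
  exact: measurable_funTS.
apply: eq_integral => x /set_mem oIx.
by rewrite /= patchE mem_set// ger0_norm ?sqr_ge0.
Qed.

Lemma test_fun_derive psi (x : R) : test_fun L psi -> is_derive x (1 : R) psi (derive1 psi x).
Proof. by move=> [/(_ 0%N x) /derivableP]; rewrite -derive1E. Qed.

Lemma test_fun_cont psi : test_fun L psi -> continuous psi /\ continuous (derive1 psi).
Proof.
move=> [sm _]; split => x; apply: differentiable_continuous; apply/derivable1_diffP.
  exact: (sm 0%N x).
exact: (sm 1%N x).
Qed.

Lemma continuous_sqint f : continuous f -> sqint 0 L f.
Proof.
move=> cf; split; first by apply: measurable_funTS; exact: continuous_measurable_fun.
by apply: integ_cont => x; apply: cvgM; exact: cf.
Qed.

Lemma continuous_bounded f : continuous f ->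
  exists M, forall x, 0 <= x <= L -> `|f x| <= M.
Proof.
move=> cf; have [|c _ H] := @EVT_max R (fun x => `|f x|) 0 L (ltW L0).
  by apply: continuous_subspaceT => x; apply: cvg_norm; exact: cf.
by exists `|f c| => x xL; apply: H; rewrite in_itv.
Qed.

Lemma primitive_weak_deriv u v : sqint 0 L v ->
  (forall x, 0 <= x <= L -> u x = intR 0 x v) -> weak_deriv L u v.
Proof.
move=> sv uE psi tpsi; have [cp cq] := test_fun_cont _ tpsi.
have [_ [c [d [c0 cd dL pE]]]] := tpsi.
have [M qM] := continuous_bounded _ cq.
have sp := continuous_sqint _ cp; have sq := continuous_sqint _ cq.
have su : sqint 0 L u.
  apply: (sqint_bdd (intR 0 L (fun x => `|v x|))).
    exact: (primitive_measurable _ _ _ (ltW L0) sv uE).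
  by move=> x; exact: (primitive_bound _ _ _ (ltW L0) sv uE).
have i1 := sqint_mul su sq; have i2 := sqint_mul sv sp.
rewrite !integral_oI// -EFinN; congr (_%:E).
have LL : 0 <= L <= L by rewrite (ltW L0) lexx.
have pq x y : 0 <= y <= x -> x <= L -> psi x - psi y = intR y x (derive1 psi).
  move=> /andP[_ yx] _; apply/esym.
  exact: (@intR_derive _ y x psi _ yx cq (fun t => test_fun_derive psi t tpsi)).
have := @product_rule _ L u v (ltW L0) sv uE M psi (derive1 psi) sp.1 sq.1 qM pq L LL.
rewrite pE ?mulr0; last by right.
by rewrite intRD// => /eqP; rewrite eq_sym addr_eq0 => /eqP.
Qed.

Lemma primitive_H10 u v : sqint 0 L v -> intR 0 L v = 0 ->
  (forall x, 0 <= x <= L -> u x = intR 0 x v) -> H10 L u v.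
Proof.
move=> sv v0 uE.
have su : sqint 0 L u.
  apply: (sqint_bdd (intR 0 L (fun x => `|v x|))).
    exact: (primitive_measurable _ _ _ (ltW L0) sv uE).
  by move=> x; exact: (primitive_bound _ _ _ (ltW L0) sv uE).
split; [exact: sqint_L2|exact: sqint_L2|exact: primitive_weak_deriv|].
have e0 n : (0 : R) < n.+1%:R^-1 by rewrite invr_gt0.
have [psi Hpsi] := choice (fun n => @H1_density _ L L0 u v sv v0 uE _ (e0 n)).
exists psi; split; first by move=> n; case: (Hpsi n).
pose r n := intR 0 L (fun x => (psi n x - u x) ^+ 2) +
  intR 0 L (fun x => (derive1 (psi n) x - v x) ^+ 2).
have spsi n : sqint 0 L (psi n) /\ sqint 0 L (derive1 (psi n)).
  by have [/test_fun_cont[c1 c2] _ _] := Hpsi n; split; exact: continuous_sqint.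
have rE : (fun n => (\int[mu]_(x in oI L) ((psi n x - u x) ^+ 2)%:E +
    \int[mu]_(x in oI L) ((derive1 (psi n) x - v x) ^+ 2)%:E)%E) =
    (fun n => (r n)%:E).
  apply/funext => n; have [s1 s2] := spsi n.
  rewrite (integral_oI (fun x => (psi n x - u x) ^+ 2) (sqintB s1 su).2).
  by rewrite (integral_oI (fun x => (derive1 (psi n) x - v x) ^+ 2) (sqintB s2 sv).2).
rewrite rE; apply: cvg_EFin; first by near=> n.
(* With e = 1 / (n + 1), the derivative contributes e, and the pointwise bound (psi - u)^2 <= L e
   integrates to L * L * e. *)
apply: (@squeeze_cvgr _ _ _ _ (fun=> 0) (fun n => (L * L + 1) * harmonic n)).
- near=> n; have [_ H1 H2] := Hpsi n; have [s1 s2] := spsi n.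
  rewrite /= /r; apply/andP; split.
    by apply: addr_ge0; apply: intR_ge0 => x _; exact: sqr_ge0.
  rewrite mulrDl mul1r lerD// -mulrA mulrC.
  have := intR_le_bd _ (ltW L0) (sqintB s1 su).2 H2.
  by rewrite subr0; apply: le_trans.
- exact: cvg_cst.
- rewrite -[X in _ --> X](mulr0 (L * L + 1)); apply: cvgM; first exact: cvg_cst.
  exact: cvg_harmonic.
Unshelve. all: by end_near. Qed.

End Weak.

(** * The nonlinearity *)

Section Nonlinearity.
Context {R : realType}.
Local Notation mu := (@lebesgue_measure R).

(** Continuity at the infinite value gives phi >= 0 near 0; away from 0 the bound is that of
    [H_bdd]. *)
Lemma singular_lower_bound (phi : R -> \bar R) : H_phi phi -> phi 0 = +oo%E ->
  H_bdd phi -> exists2 M : R, 0 <= M & forall s, ((- M)%:E <= phi s)%E.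
Proof.
move=> [cphi _ _] phi0 Hb.
have : nbhs (0 : R) (fun s => 0%:E <= phi s)%E.
  by have := cphi 0; rewrite /continuous_at phi0 => /cvgeyPge; exact.
move=> /nbhs_ballP[d /= d0 Hd].
have [[M HM] _] := Hb _ d0.
exists `|M| => // s; have [sd|sd] := ltP `|s| d.
  apply: (@le_trans _ _ 0%:E); first by rewrite lee_fin oppr_le0.
  by apply: Hd; rewrite /ball/= sub0r normrN.
have := HM _ sd; case: (phi s) => [r| |]//=.
rewrite !lee_fin => rM; rewrite lerNl; apply: le_trans (ler_norm _) _.
by rewrite normrN (le_trans rM)// ler_norm.
Qed.

Lemma singular_measurable (f : R -> \bar R) : continuous f ->
  (forall s, (0 <= f s)%E) -> (forall s, s != 0 -> (f s < +oo)%E) ->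
  f 0 = +oo%E -> measurable_fun setT f.
Proof.
move=> cf f_ge0 f_fin f0.
apply: (@emeasurable_fun_cvg _ _ _ _ (fun n s => (infconv f n s)%:E)) => [n|x _].
  apply/measurable_EFinP; apply: continuous_measurable_fun.
  by apply: (@lipschitz_continuous _ n%:R) => r s; exact: infconv_lipschitz.
exact: (@infconv_cvg _ f cf f_ge0 f_fin f0 (fun=> x) x (cvg_cst x)).
Qed.

(** The integral of a signed function is a difference. The negative part is at most M on a set of
    finite measure, so a bound on the difference forces the positive part to be integrable. *)
Lemma integral_shift_fin (D : set R) (phi : R -> \bar R) (M : R) : measurable D ->
  (mu D < +oo)%E -> 0 <= M -> measurable_fun D phi ->
  (forall s, ((- M)%:E <= phi s)%E) ->
  (\int[mu]_(t in D) phi t < +oo)%E ->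
  (\int[mu]_(t in D) (phi t + M%:E) < +oo)%E.
Proof.
move=> mD muD M0 mphi phiM iphi.
have mpos : measurable_fun D phi^\+%E by exact: measurable_funepos.
have mneg : measurable_fun D phi^\-%E by exact: measurable_funeneg.
have icst : (\int[mu]_(t in D) M%:E < +oo)%E.
  by rewrite integral_cst// lte_mul_pinfty ?lee_fin.
have ineg : (\int[mu]_(t in D) phi^\- t < +oo)%E.
  apply: le_lt_trans icst; apply: ge0_le_integral => //.
  - move=> t _; rewrite funenegE ge_max lee_fin M0 andbT.
    by rewrite leeNl -EFinN; exact: phiM.
have ineg0 : (0 <= \int[mu]_(t in D) phi^\- t)%E by exact: integral_ge0.
have ipos : (\int[mu]_(t in D) phi^\+ t < +oo)%E.
  rewrite ltNge leye_eq; apply/negP => /eqP E; move: iphi.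
  rewrite integralE E addye ?ltxx// eqe_oppLR /=.
  by rewrite lt_eqF.
apply: (@le_lt_trans _ _ (\int[mu]_(t in D) (phi^\+ t + M%:E))%E).
  apply: ge0_le_integral => //.
  - move=> t _; have := phiM t; case: (phi t) => [r| |]//=.
      by rewrite -EFinD !lee_fin; lra.
    by rewrite addye// leey.
  - by apply: emeasurable_funD => //; exact: measurable_cst.
  - by apply: emeasurable_funD => //; exact: measurable_cst.
  - by move=> t _; rewrite leeD2r// funeposE le_max lexx.
by rewrite ge0_integralD//; rewrite lte_add_pinfty.
Qed.

(** [C0] is the integral of [f] over (0, 1/2) and the linear term comes from the bound on [f] beyond
    1/2, so both constants serve every continuous minorant. *)
Lemma minorant_primitive_bound (f : R -> \bar R) (M : R) : 0 <= M ->
  measurable_fun setT f -> (forall s, (0 <= f s)%E) ->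
  (\int[mu]_(t in (`]0%R, (2^-1)%R[ : set R)) f t < +oo)%E ->
  (forall s, 2^-1 <= `|s| -> (f s <= M%:E)%E) ->
  exists2 C0 : R, 0 <= C0 & forall F : R -> R, continuous F -> (forall s, 0 <= F s) ->
    (forall s, ((F s)%:E <= f s)%E) -> forall s, 0 <= s -> intR 0 s F <= C0 + M * s.
Proof.
move=> M0 mf f0 fi fM.
have fi0 : (0 <= \int[mu]_(t in (`]0%R, (2^-1)%R[ : set R)) f t)%E by exact: integral_ge0.
exists (fine (\int[mu]_(t in (`]0%R, (2^-1)%R[ : set R)) f t)%E); first exact: fine_ge0.
move=> F cF F0 Ff.
have iF x y : integ x y F by exact: integ_cont.
have half : intR 0 2^-1 F <= fine (\int[mu]_(t in (`]0%R, (2^-1)%R[ : set R)) f t)%E.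
  have E1 : (intR 0 2^-1 F)%:E = (\int[mu]_(t in `[0%R, (2^-1)%R]) (F t)%:E)%E.
    by rewrite /intR /Rintegral fineK//; exact: (integrable_fin_num _ (iF _ _)).
  rewrite -lee_fin E1 fineK ?ge0_fin_numE//.
  have mF : measurable_fun (`]0%R, 2^-1[ : set R) (EFin \o F).
    by apply/measurable_EFinP; apply: measurable_funTS; exact: continuous_measurable_fun.
  rewrite (@integral_itv_bndoo _ 0 2^-1 (EFin \o F) true false)//.
  apply: ge0_le_integral => //.
  - by move=> t _; rewrite lee_fin.
  - exact: measurable_funTS.
  - by move=> t _; exact: Ff.
move=> s s0; have [s2|s2] := leP s 2^-1.
  apply: (@le_trans _ _ (intR 0 2^-1 F)); first by apply: intR_incr.
  by apply: le_trans half _; rewrite lerDl mulr_ge0.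
rewrite (@intR_chasles _ 0 2^-1 s)// ?invr_ge0 ?ler0n ?(ltW s2)// lerD//.
apply: (@le_trans _ _ (M * (s - 2^-1))).
  apply: intR_le_bd => //; first exact: ltW.
  move=> t /andP[t2 _]; rewrite -lee_fin; apply: le_trans (Ff _) _.
  by apply: fM; rewrite (le_trans t2)// ler_norm.
by rewrite ler_wpM2l// gerBl invr_ge0.
Qed.

(** Truncation at [al] makes inversion globally Lipschitz, so that [measurable_lipschitz_comp]
    yields the measurability of the inverse coefficient. *)
Lemma inv_max_lipschitz (al : R) : 0 < al -> forall r s,
  `|(Num.max al r)^-1 - (Num.max al s)^-1| <= (al ^+ 2)^-1 * `|r - s|.
Proof.
move=> al0 r s; set p := Num.max al r; set q := Num.max al s.
have pal : al <= p by rewrite le_max lexx.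
have qal : al <= q by rewrite le_max lexx.
have p0 := lt_le_trans al0 pal; have q0 := lt_le_trans al0 qal.
have -> : p^-1 - q^-1 = (q - p) * (p * q)^-1 by field; rewrite !gt_eqF.
rewrite normrM mulrC; apply: ler_pM => //.
  rewrite normfV gtr0_norm ?mulr_gt0// lef_pV2 ?posrE ?mulr_gt0 ?exprn_gt0//.
  by rewrite expr2 ler_pM// ltW.
have := ler_norm (r - s); have := ler_norm (- (r - s)); rewrite normrN => H1 H2.
rewrite ler_norml /p /q; apply/andP.
by case: (leP al r) => ?; case: (leP al s) => ?; split; lra.
Qed.

End Nonlinearity.

(** * Crossing of the two solutions and construction of the datum *)

Theorem mainTheorem15 (R : realType) (L : R) (a : R -> R) (phi : R -> \bar R) :
  0 < L -> H_a L a -> H_phi phi -> phi 0 = +oo%E -> H_int phi -> H_bdd phi ->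
  forall g : R -> R, L2 L g ->
  forall delta : R, 0 < delta < L ->
  exists ghat : R -> R,
    [/\ L2 L ghat,
        {ae (@lebesgue_measure R), forall x, x \in `[0, L - delta] -> ghat x = g x} &
        exists u : R -> R, weak_solution L a ghat phi u].
Proof.
move=> L0 [ma [al [be [al0 albe aB]]]] Hphi phi0 Hi Hb g Lg de /andP[de0 deL].
pose mu := @lebesgue_measure R.
have be0 : 0 < be by exact: lt_trans albe.
have [cphi phiNy phi_fin] := Hphi.
have [M M0 phiM] := singular_lower_bound _ Hphi phi0 Hb.
pose f s := (phi s + M%:E)%E.
have f_ge0 s : (0 <= f s)%E.
  rewrite /f; have := phiM s; case: (phi s) => [r| |]//=.
    by rewrite -EFinD !lee_fin; lra.
  by rewrite addye// leey.
have cf : continuous f.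
  by move=> s; apply: cvgeD; [exact: fin_num_adde_defl|exact: cphi|exact: cvg_cst].
have f_fin s : s != 0 -> (f s < +oo)%E.
  by move=> /phi_fin ps; rewrite /f lte_add_pinfty// ltry.
have f0 : f 0 = +oo%E by rewrite /f phi0 addye.
have mf := singular_measurable f cf f_ge0 f_fin f0.
have phiE s : phi s = (f s - M%:E)%E.
  by rewrite /f addeK.
have mphi : measurable_fun setT phi.
  rewrite (_ : phi = fun s => f s - M%:E)%E; last exact/funext.
  by apply: emeasurable_funB => //; exact: measurable_cst.
have [C0 C00 fM] : exists2 C0 : R, 0 <= C0 & exists2 M2 : R, 0 <= M2 &
    forall F : R -> R, continuous F -> (forall s, 0 <= F s) ->
    (forall s, ((F s)%:E <= f s)%E) -> forall s, 0 <= s -> intR 0 s F <= C0 + M2 * s.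
  have h2 : (0 : R) < 2^-1 by rewrite invr_gt0.
  have [[M1 HM1] _] := Hb _ h2.
  have M10 : 0 <= `|M1| + M by rewrite addr_ge0.
  have fi : (\int[mu]_(t in (`]0%R, (2^-1)%R[ : set R)) f t < +oo)%E.
    apply: integral_shift_fin => //.
    - by rewrite lebesgue_measure_itv/= lte_fin h2 -EFinB ltry.
    - exact: measurable_funTS.
    - by have /Hi[] : 0 < (2^-1 : R) < 1 by rewrite h2 invf_lt1// ltr1n.
  have fM1 s : 2^-1 <= `|s| -> (f s <= (`|M1| + M)%:E)%E.
    move=> /HM1; rewrite /f; case: (phi s) => [r| |]//=.
    rewrite -EFinD !lee_fin => rM; rewrite lerD2r.
    by apply: le_trans (ler_norm _) _; apply: le_trans rM _; exact: ler_norm.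
  have [C0 C00 H] := minorant_primitive_bound f _ M10 mf f_ge0 fi fM1.
  by exists C0 => //; exists (`|M1| + M).
have [M2 M20 {}fM] := fM.
(* The bounds on [a] hold almost everywhere on the open interval only. Extending by 0 and clamping
   to [al, be] gives a representative bounded at every point, as [singular_ode] demands. *)
pose a1 := a \_ (oI L).
pose a2 x := Num.max al (Num.min (a1 x) be).
have ma1 : measurable_fun setT a1.
  by apply/(measurable_restrictT a) => //; exact: measurable_itv.
have mmin : measurable_fun setT (fun x => Num.min (a1 x) be).
  by apply: measurable_minr => //; exact: measurable_cst.
have ma2 : measurable_fun setT a2.
  by apply: measurable_maxr => //; exact: measurable_cst.
have a2B x : al <= a2 x <= be.
  by rewrite /a2 le_max lexx ge_max ge_min lexx orbT (ltW albe).
have aa2 : {ae mu, forall x, x \in `]0, L[ -> a x = a2 x}.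
  apply: filterS aB => x H xL; have /andP[h1 h2] := H xL.
  rewrite /a2 /a1 patchE mem_set//.
  by rewrite (min_idPl h2) (max_idPr h1).
pose b x := (a2 x)^-1.
have a2_gt0 x : 0 < a2 x by have /andP[h _] := a2B x; exact: lt_le_trans h.
have bB x : be^-1 <= b x <= al^-1.
  by have /andP[h1 h2] := a2B x; rewrite /b !lef_pV2 ?posrE// h1 h2.
have mb : measurable_fun `[0, L] b.
  apply: (measurable_lipschitz_comp (al ^+ 2)^-1 (fun s => (Num.max al s)^-1)).
    exact: inv_max_lipschitz.
  exact: measurable_funTS.
pose g1 := g \_ (oI L).
have sg1 : sqint 0 L g1 by exact: L2_sqint.
have sbdd c : sqint 0 L (fun=> c) by apply: (sqint_bdd `|c|).
have sgM : sqint 0 L (fun x => g1 x - M) by exact: sqintB.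
have be'0 : 0 < be^-1 by rewrite invr_gt0.
have al'0 : 0 < al^-1 by rewrite invr_gt0.
have bB' x : 0 <= x <= L -> `|b x| <= al^-1.
  move=> _; have /andP[h1 h2] := bB x; rewrite ger0_norm//.
  exact: le_trans (ltW be'0) h1.
pose m0 := L - de.
have m0L : 0 <= m0 <= L by rewrite /m0; apply/andP; split; lra.
have /andP[m00 m0L'] := m0L.
pose J := intR 0 m0 (fun x => b x * (g1 x - M)).
(* A large constant on the free interval forces u1 L > 0. *)
pose La := (`|J| + 1) * be / de.
pose G1 x := if x <= m0 then g1 x - M else La.
have sG1 : sqint 0 L G1 by exact: sqint_glue.
have bB2 x : 0 <= x <= L -> be^-1 <= b x <= al^-1 by move=> _; exact: bB.
have [u1 [fin1 sf1 u1E]] := @singular_ode R L be^-1 al^-1 C0 M2 b G1 f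
  L0 be'0 C00 M20 mb bB2 sG1 cf f_ge0 f_fin f0 fM.
pose v1 x := b x * (fine (f (u1 x)) + G1 x).
have sv1 : sqint 0 L v1.
  by apply: (sqintM_bdd al^-1) => //; exact: sqintD.
have LL : 0 <= L <= L by rewrite (ltW L0) lexx.
have b0 x : 0 <= b x by have /andP[h1 _] := bB x; exact: le_trans (ltW be'0) h1.
have u1L : 0 < u1 L.
  rewrite u1E// -/v1.
  have sbG : sqint 0 L (fun x => b x * G1 x) by exact: (sqintM_bdd al^-1).
  have ibG := sqint_integ sbG.
  apply: (@lt_le_trans _ _ (intR 0 L (fun x => b x * G1 x))); last first.
    apply: intR_le => //; first exact: sqint_integ.
    by move=> x _; rewrite ler_wpM2l// lerDr fine_ge0.
  rewrite (@intR_chasles _ 0 m0 L)//.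
  rewrite (@intR_eq _ 0 m0 _ (fun x => b x * (g1 x - M))); last first.
    by move=> x /andP[_ xm]; rewrite /G1 xm.
  rewrite -/J; have sb : sqint m0 L b.
    by apply: (sqint_sub (sqint_bdd al^-1 mb bB')) => //; exact: lexx.
  (* As b >= 1 / be and the free interval has length [de], the choice of [La] makes this piece at
     least |J| + 1, which outweighs the contribution [J] of [0, m0]. *)
  have H : be^-1 * La * (L - m0) <= intR m0 L (fun x => b x * G1 x).
    rewrite -intR_cst//; apply: (@le_trans _ _ (intR m0 L (fun x => La * b x))).
      apply: intR_le; [exact: integ_cst|exact/integZ/sqint_integ|].
      move=> x _; rewrite mulrC ler_wpM2l//; last by have /andP[] := bB x.
      by rewrite /La divr_ge0 ?mulr_ge0 ?addr_ge0// ltW.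
    rewrite (@intR_eq_oo _ m0 L (fun x => La * b x) (fun x => b x * G1 x))//.
    - exact: (sqintZ La sb).1.
    - exact: (sqint_sub sbG m00 (lexx L)).1.
    - by move=> x /andP[mx _]; rewrite /G1 leNgt mx/= mulrC.
  have E : be^-1 * La * (L - m0) = `|J| + 1.
    by rewrite /La /m0; field; rewrite !gt_eqF.
  by rewrite E in H; have := ler_norm (- J); rewrite normrN; lra.
(* Backward solution from the right end point, with speed large enough to
   overtake u1. *)
pose La2 := (`|u1 m0| + 1) / de.
have b1B (x : R) : 0 <= x <= L -> is_true (((1 : R) <= 1) && ((1 : R) <= 1)).
  by rewrite lexx.
(* Where the datum is free the coefficient of the auxiliary equation is free too, so b = 1 will do;
   [ghat] absorbs the difference. Only the values of [w] on [0, L - m] are used in the end. *)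
have [w [fin2 sf2 wE]] := @singular_ode R L 1 1 C0 M2 (fun=> 1) (fun=> La2) f
  L0 ltr01 C00 M20 (measurable_cst _) b1B (sbdd La2) cf f_ge0 f_fin f0 fM.
pose v2 x := 1 * (fine (f (w x)) + La2).
have sv2 : sqint 0 L v2.
  apply: sqintZ; apply: sqintD => //.
have deLL : 0 <= de <= L by rewrite (ltW de0) (ltW deL).
have wde : u1 m0 < w de.
  rewrite wE// -/v2; apply: (@lt_le_trans _ _ (intR 0 de (fun=> La2))).
    rewrite intR_cst ?(ltW de0)// subr0 /La2 divfK ?gt_eqF//.
    by apply: le_lt_trans (ler_norm _) _; rewrite ltrDl.
  apply: intR_le; first exact: integ_cst.
    exact: (integ_sub (sqint_integ sv2) (lexx _) (ltW deL)).
  by move=> x _; rewrite /v2 mul1r lerDr fine_ge0.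
have sr2 : sqint 0 L (fun t => v2 (L - t)) by apply: sqint_reflect; rewrite subrr subr0.
have wrE x : 0 <= x <= L -> w (L - x) = w L - intR 0 x (fun t => v2 (L - t)).
  move=> /andP[x0 xL]; have iv2 := sqint_integ sv2.
  rewrite intR_reflect; last by apply: (integ_sub iv2); lra.
  rewrite subr0 !wE//; last by apply/andP; split; lra.
  by rewrite (@intR_chasles _ 0 (L - x) L)// ?addrK//; apply/andP; split; lra.
(* Up to the constant w L this is the gap u1 x - w (L - x), written as one primitive so that
   [intR_cont] gives continuity. The gap is negative at m0 by [wde] and positive at L by [u1L],
   since w 0 = 0. *)
pose D x := intR 0 x (fun t => v1 t + v2 (L - t)).
have iv12 : integ 0 L (fun t => v1 t + v2 (L - t)).
  by apply: integD; exact: sqint_integ.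
have DE x : 0 <= x <= L -> u1 x - w (L - x) = D x - w L.
  move=> xL; have /andP[_ xL'] := xL.
  rewrite wrE// u1E// /D intRD; first by rewrite -/v1; ring.
    exact: (integ_sub (sqint_integ sv1) (lexx _) xL').
  exact: (integ_sub (sqint_integ sr2) (lexx _) xL').
have [m m0mL Dm] : exists2 m, m \in `[m0, L] & D m = w L.
  apply: IVT => //.
    apply: (@continuous_subspaceW _ _ _ `[0, L]).
      by move=> x /=; rewrite !in_itv/= => /andP[mx ->]; rewrite (le_trans m00).
    exact: intR_cont (ltW L0) iv12.
  have w0 : w 0 = 0 by rewrite wE ?intR_pt// lexx ltW.
  have h1 : D m0 <= w L.
    by have := DE _ m0L; rewrite /m0 subKr -/m0 => h; have := wde; lra.
  have h2 : w L <= D L by have := DE _ LL; rewrite subrr w0 => h; have := u1L; lra.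
  by rewrite ge_min h1 le_max h2 orbT.
move: m0mL; rewrite in_itv/= => /andP[m0m mL].
have mLL : 0 <= m <= L by rewrite (le_trans m00 m0m).
have um : u1 m = w (L - m) by have := DE _ mLL; rewrite Dm; lra.
pose v x := if x <= m then v1 x else - v2 (L - x).
pose u x := if x <= m then u1 x else w (L - x).
have uE : forall x, 0 <= x <= L -> u x = intR 0 x v.
  exact: (@glue_primitive R L m u1 v1 w v2 mLL sv1 sv2 u1E wE um).
have sr2' : sqint 0 L (fun t => - v2 (L - t)).
  by have := sqintZ (-1) sr2; under eq_fun do rewrite mulN1r.
have sv : sqint 0 L v by exact: sqint_glue.
have uL : u L = 0.
  rewrite /u; case: leP => [Lm|_]; last by rewrite subrr wE ?intR_pt// lexx ltW.
  have -> : L = m by apply/eqP; rewrite eq_le Lm mL.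
  by rewrite um (_ : m = L) ?subrr ?wE ?intR_pt ?lexx ?ltW//; apply/eqP; rewrite eq_le Lm mL.
have v0 : intR 0 L v = 0 by rewrite -uE.
have HH := primitive_H10 L L0 u v sv v0 uE.
have finu : {ae mu, forall x, 0 <= x <= L -> f (u x) \is a fin_num}.
  have fin2' := ae_reflect L _ fin2.
  apply: filterS2 fin1 fin2' => x H1 H2 xL; rewrite /u; case: ifP => _; first exact: H1.
  by apply: H2; move: xL => /andP[? ?]; apply/andP; split; lra.
have sfu : sqint 0 L (fun x => fine (f (u x))).
  rewrite (_ : (fun x => fine (f (u x))) =
    fun x => if x <= m then fine (f (u1 x)) else fine (f (w (L - x)))); last first.
    by apply/funext => x; rewrite /u; case: ifP.
  apply: sqint_glue => //.
  by apply: (sqint_reflect L 0 L (fun t => fine (f (w t)))); rewrite subrr subr0.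
have mu_ : measurable_fun `[0, L] u by exact: (primitive_measurable _ _ _ (ltW L0) sv uE).
(* Domination rather than a shift by M: where phi (u x) is infinite, [fine] sends both phi and f to
   0. *)
have sphi : sqint 0 L (fun x => fine (phi (u x))).
  apply: (sqint_le (fun x => fine (f (u x)) + M)); first exact: sqintD.
    by do 2 apply: measurableT_comp => //.
  move=> x _; rewrite /f; have := phiM (u x); case: (phi (u x)) => [r| |]//=.
    rewrite lee_fin => Mr; rewrite ler_norml; apply/andP; split; lra.
  by rewrite normr0 add0r.
pose ghat x := a2 x * v x - fine (phi (u x)).
have ma2' : measurable_fun `[0, L] a2 by exact: measurable_funTS.
have a2n x : 0 <= x <= L -> `|a2 x| <= be.
  by move=> _; have /andP[_ h] := a2B x; rewrite gtr0_norm.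
have sav : sqint 0 L (fun x => a2 x * v x) by exact: (sqintM_bdd be).
have sghat : sqint 0 L ghat by exact: sqintB.
exists ghat; split; first exact: sqint_L2.
  (* Before m0 <= m the glued function is u1 and a2 b = 1, so [ghat] reduces to g. Finiteness of f
     (u1 x) lets M cancel under [fine], and x = 0 is excluded because [g1] agrees with [g] on the
     open interval only. *)
  apply: filterS2 fin1 (ae_neq 0) => x H xn0; rewrite in_itv/= => /andP[x0 xm0].
  have xL : 0 <= x <= L by rewrite x0 (le_trans xm0).
  have xm : x <= m by exact: le_trans m0m.
  have xo : oI L x.
    rewrite /oI/= in_itv/= lt_neqAle eq_sym xn0 x0/=; apply: le_lt_trans xm0 _.
    by rewrite ltrBlDr ltrDl.
  rewrite /ghat /v /u xm /v1 /b mulrA mulfV ?gt_eqF// mul1r /G1 /m0 xm0 /g1 patchE mem_set//.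
  have := H xL; rewrite /f; case: (phi (u1 x)) (phiNy (u1 x)) => [r| |]//= _ _; ring.
exists u, v; split => //.
- apply: filterS finu => x H; rewrite in_itv/= => /andP[/ltW x0 /ltW xL].
  have := H; rewrite x0 xL => /(_ isT); rewrite /f.
  by case: (phi (u x)) (phiNy (u x)).
- exact: sqint_L2.
move=> psi tpsi.
have [_ cq] := test_fun_cont _ _ tpsi.
have sq := continuous_sqint L _ cq.
have i1 := sqint_mul sav sq; have i2 := sqint_mul sphi sq; have i3 := sqint_mul sghat sq.
have -> : (\int[mu]_(x in oI L) (a x * v x * derive1 psi x)%:E =
    \int[mu]_(x in oI L) (a2 x * v x * derive1 psi x)%:E)%E.
  have sub : oI L `<=` `[0, L]%classic.
    by move=> x; rewrite /oI/= !in_itv/= => /andP[/ltW -> /ltW ->].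
  apply: ae_eq_integral => //.
  - exact: measurable_itv.
  - apply/measurable_EFinP; apply: measurable_funM; last exact: measurable_funS sub sq.1.
    by apply: measurable_funM => //; exact: measurable_funS sub sv.1.
  - by apply/measurable_EFinP; exact: measurable_funS sub (integ_meas i1).
  - by apply: filterS aa2 => x H xL; rewrite H.
rewrite !integral_oI// -EFinD; congr (_%:E).
rewrite -intRD//; apply: intR_eq => x _.
by rewrite /ghat; ring.
Qed.
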